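(* Let $\mathbb{C}$ be a framed bicategory such that the category $\mathbb{C}_1$ of horizontal arrows and squares has equalizers and the source and target functors $\partial_0, \partial_1 : \mathbb{C}_1 \to \mathbb{C}_0$ preserve them. If the horizontal 2-category $\mathcal{H}_{\mathbb{C}}$ of $\mathbb{C}$ has local coproducts and admits the construction of free monads, then the double category $\mathbb{C}$ admits the construction of free monads.
   Context: **Double categories.** A double category $\mathbb{C}$ has objects, horizontal arrows, vertical arrows and squares. Horizontal composition is allowed to be associative and unital only up to coherent invertible squares, but is written as if it were strict; vertical composition is strict. $\mathbb{C}_0$ is the category of objects and vertical arrows; $\mathbb{C}_1$ is the category of horizontal arrows and squares (composed vertically). A square $\alpha : F \Rightarrow F'$ with top $F : X \to Y$, bottom $F' : X' \to Y'$, left side $u : X \to X'$ and right side $v : Y \to Y'$ is said to have boundary $(u,v)$; it is globular if $u,v$ are identities. $\partial_0,\partial_1 : \mathbb{C}_1 \to \mathbb{C}_0$ send $F : X \to Y$ to $X$ and $Y$, respectively, and $\alpha$ to $u$ and $v$, respectively. Vertical composition of squares is written $\beta \circ \alpha$ (first $\alpha$, then $\beta$ below it). For $\alpha : F \Rightarrow F'$ with boundary $(u,v)$ and $\beta : G \Rightarrow G'$ with boundary $(v,w)$, the horizontal composite is written $\beta * \alpha : GF \Rightarrow G'F'$, with boundary $(u,w)$. $1_F$ denotes the vertical identity square on a horizontal arrow $F$; $1_u : 1_X \Rightarrow 1_{X'}$ denotes the horizontal identity square on a vertical arrow $u$. The horizontal 2-category $\mathcal{H}_{\mathbb{C}}$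 has the objects of $\mathbb{C}$ as 0-cells, the horizontal arrows as 1-cells and the globular squares as 2-cells. $\mathbb{C}$ is a framed bicategory if $(\partial_0,\partial_1) : \mathbb{C}_1 \to \mathbb{C}_0 \times \mathbb{C}_0$ is a Grothendieck fibration (equivalently, a Grothendieck opfibration). **Free monads in a 2-category $\mathcal{K}$.** An endomorphism is a pair $(X,P)$ with $P : X \to X$ a 1-cell. An endomorphism map $(F,\phi) : (X,P) \to (Y,Q)$ is a 1-cell $F : X \to Y$ with a 2-cell $\phi : QF \to FP$. An endomorphism 2-cell $(F,\phi) \to (F',\phi')$ is a 2-cell $\alpha : F \to F'$ with $(\alpha P)\phi = \phi'(Q\alpha)$. These form a 2-category $\mathrm{End}_{\mathcal{K}}$. A monad is an endomorphism $(X,P)$ with 2-cells $\mu_P : PP \to P$, $\eta_P : 1_X \to P$ satisfying associativity and unit laws. A monad map is an endomorphism map $(F,\phi)$ between monads with $\phi(\mu_Q F) = (F\mu_P)(\phi P)(Q\phi)$ and $\phi(\eta_Q F) = F\eta_P$; monad 2-cells are endomorphism 2-cells. These form a 2-category $\mathrm{Mnd}_{\mathcal{K}}$. $\mathcal{K}$ admits the construction of free monads if for every endomorphism $(Y,Q)$ there are a monad $(Y,Q^* )$ and a 2-cell $\iota_Q : Q \to Q^*$ such that for every monad $(X,P)$, composition with the endomorphism map $(1_Y,\iota_Q) : (Y,Q^* ) \to (Y,Q)$ gives an isomorphism of categories $\mathrm{Mnd}_{\mathcal{K}}((X,P),(Y,Q^* )) \cong \mathrm{End}_{\mathcal{K}}((X,P),(Y,Q))$,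 commuting with the forgetful functors to $\mathcal{K}(X,Y)$. Equivalently: letting $\nu_{Q^*}=\mu_{Q^*}(\iota_Q Q^* ) : QQ^* \to Q^*$, for every $X$ the functor $F \mapsto (Q^*F, \nu_{Q^*}F)$ is left adjoint to the forgetful functor $Q\text{-alg}_X \to \mathcal{K}(X,Y)$, where $Q\text{-alg}_X = \mathrm{End}_{\mathcal{K}}((X,1_X),(Y,Q))$. $\mathcal{K}$ has local coproducts if its hom-categories have coproducts. (If $\mathcal{H}_{\mathbb{C}}$ is only a bicategory, the same notions apply with coherence isomorphisms inserted.) **Double categories $\mathrm{End}(\mathbb{C})$ and $\mathrm{Mnd}(\mathbb{C})$.** Objects of $\mathrm{End}(\mathbb{C})$: endomorphisms $(X,P)$, with $P : X \to X$ a horizontal arrow. Horizontal endomorphism maps $(F,\phi) : (X,P) \to (Y,Q)$: a horizontal arrow $F : X \to Y$ and a globular square $\phi : QF \Rightarrow FP$; they compose by $(G,\psi)(F,\phi) = (GF, (1_G * \phi)\circ(\psi * 1_F))$. Vertical endomorphism maps $(u,\bar u) : (X,P) \to (X',P')$: a vertical arrow $u : X \to X'$ and a square $\bar u : P \Rightarrow P'$ with boundary $(u,u)$. Endomorphism squares with top $(F,\phi) : (X,P)\to(Y,Q)$, bottom $(F',\phi') : (X',P')\to(Y',Q')$, left $(u,\bar u)$, right $(v,\bar v)$: squares $\alpha : F \Rightarrow F'$ of $\mathbb{C}$ with boundary $(u,v)$ such that $(\alpha * \bar u)\circ\phi = \phi'\circ(\bar v * \alpha)$. Objects of $\mathrm{Mnd}(\mathbb{C})$: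 monads, i.e. endomorphisms $(X,P)$ with globular squares $\mu_P : PP \Rightarrow P$, $\eta_P : 1_X \Rightarrow P$ satisfying $\mu_P\circ(\mu_P*1_P)=\mu_P\circ(1_P*\mu_P)$ and $\mu_P\circ(\eta_P*1_P)=1_P=\mu_P\circ(1_P*\eta_P)$. Horizontal monad maps: horizontal endomorphism maps $(F,\phi)$ with $\phi\circ(\mu_Q*1_F) = (1_F*\mu_P)\circ(\phi*1_P)\circ(1_Q*\phi)$ and $\phi\circ(\eta_Q*1_F)=1_F*\eta_P$. Vertical monad maps: vertical endomorphism maps with $\bar u\circ\mu_P=\mu_{P'}\circ(\bar u*\bar u)$ and $\bar u\circ\eta_P=\eta_{P'}\circ 1_u$. Monad squares: endomorphism squares between the underlying endomorphism maps. $U : \mathrm{Mnd}(\mathbb{C}) \to \mathrm{End}(\mathbb{C})$ is the forgetful double functor. **Free monads in a double category.** $\mathbb{C}$ admits the construction of free monads if $U$ has a vertical left adjoint, i.e. a left adjoint in the 2-category of double categories, double functors and vertical natural transformations. Explicitly, this amounts to the following data: (i) for every endomorphism $(X,P)$ a monad $(X^*,P^* )$; (ii) for every endomorphism $(X,P)$ a vertical endomorphism map $(\iota_X,\iota_P) : (X,P) \to (X^*,P^* )$ such that every vertical endomorphism map $(u,\bar u)$ from $(X,P)$ to a monad $(X',P')$ factors as $(u^\sharp,\bar u^\sharp)\circ(\iota_X,\iota_P)$ for a unique vertical monad map $(u^\sharp,\bar u^\sharp) : (X^*,P^* ) \to (X',P')$; (iii) for every horizontal endomorphism map $(F,\phi)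 : (X,P) \to (Y,Q)$ a horizontal monad map $(F^*,\phi^* ) : (X^*,P^* ) \to (Y^*,Q^* )$; (iv) for every such $(F,\phi)$ an endomorphism square $\iota_{(F,\phi)}$ with top $(F,\phi)$, bottom $(F^*,\phi^* )$, left $(\iota_X,\iota_P)$, right $(\iota_Y,\iota_Q)$, such that for every endomorphism square $\alpha$ with top $(F,\phi)$, left $(u,\bar u)$, right $(v,\bar v)$ and bottom a horizontal monad map $(F',\phi') : (X',P') \to (Y',Q')$ there is a unique monad square $\alpha^\sharp$ with top $(F^*,\phi^* )$, bottom $(F',\phi')$, left $(u^\sharp,\bar u^\sharp)$, right $(v^\sharp,\bar v^\sharp)$ and $\alpha=\alpha^\sharp\circ\iota_{(F,\phi)}$; subject to: the assignments (i),(iii) are functorial with respect to horizontal composition and identities, and the assignments (ii),(iv) are functorial from objects and horizontal arrows of $\mathrm{End}(\mathbb{C})$ to vertical arrows and squares of $\mathrm{End}(\mathbb{C})$ under horizontal composition. *)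

(* Defs.v *)
From Stdlib Require Import ProofIrrelevance.
Set Implicit Arguments.
Unset Strict Implicit.

Record Category : Type := {
  obj :> Type;
  hom : obj -> obj -> Type;
  idm : forall A, hom A A;
  comp : forall A B C, hom B C -> hom A B -> hom A C;
  comp_idl : forall A B (f : hom A B), comp (idm B) f = f;
  comp_idr : forall A B (f : hom A B), comp f (idm A) = f;
  comp_assoc : forall A B C D (h : hom C D) (g : hom B C) (f : hom A B),
    comp h (comp g f) = comp (comp h g) f
}.
Arguments idm {_} A.

Notation "g ∘ f" := (comp g f) (at level 40, left associativity).

Record Functor (C D : Category) : Type := {
  fob :> C -> D;
  fmap : forall A B : C, hom A B -> hom (fob A) (fob B);
  fmap_id : forall A : C, fmap (idm A) = idm (fob A);
  fmap_comp : forall (A B E : C) (g : hom B E) (f : hom A B),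
    fmap (g ∘ f) = fmap g ∘ fmap f
}.

Definition comp_functor (C D E : Category) (G : Functor D E) (F : Functor C D)
  : Functor C E.
Proof.
refine {| fob := fun A => G (F A); fmap := fun A B f => fmap G (fmap F f) |}.
- intros A. rewrite fmap_id. apply fmap_id.
- intros A B K g f. rewrite fmap_comp. apply fmap_comp.
Defined.

Definition prod_cat (C D : Category) : Category.
Proof.
refine {| obj := (C * D)%type;
          hom := fun A B => (hom (fst A) (fst B) * hom (snd A) (snd B))%type;
          idm := fun A => (idm (fst A), idm (snd A));
          comp := fun A B E g f => (fst g ∘ fst f, snd g ∘ snd f) |}.
- intros A B [f f']. simpl. rewrite !comp_idl. reflexivity.
- intros A B [f f']. simpl. rewrite !comp_idr. reflexivity.
- intros A B K L h g f. simpl. rewrite !comp_assoc. reflexivity.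
Defined.

Definition pair_functor (C D E : Category) (F : Functor C D) (G : Functor C E)
  : Functor C (prod_cat D E).
Proof.
refine {| fob := fun A => (F A, G A) : prod_cat D E;
          fmap := fun A B f =>
            (fmap F f, fmap G f) : @hom (prod_cat D E) (F A, G A) (F B, G B) |}.
- intros A. rewrite !fmap_id. reflexivity.
- intros A B K g f. rewrite !fmap_comp. reflexivity.
Defined.

(** The category with objects [D] and with morphisms those of [C] between the
    images under [U : D -> C]. *)
Definition induced_cat (C : Category) (D : Type) (U : D -> C) : Category :=
  {| obj := D;
     hom := fun A B => hom (U A) (U B);
     idm := fun A => idm (U A);
     comp := fun A B E g f => g ∘ f;
     comp_idl := fun A B f => comp_idl f;
     comp_idr := fun A B f => comp_idr f;
     comp_assoc := fun A B E L h g f => comp_assoc h g f |}.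

Definition induced_functor (C : Category) (D : Type) (U : D -> C)
  : Functor (induced_cat U) C :=
  {| fob := U : induced_cat U -> C;
     fmap := fun (A B : induced_cat U) (f : hom A B) => f;
     fmap_id := fun A => eq_refl;
     fmap_comp := fun A B E g f => eq_refl |}.

Definition is_isomorphism_of_categories (C D : Category) (F : Functor C D)
  : Prop :=
  (forall B : D, exists! A : C, F A = B) /\
  (forall (A A' : C) (g : hom (F A) (F A')), exists! f : hom A A', fmap F f = g).

Definition is_equalizer (C : Category) (A B E : C) (f g : hom A B) (e : hom E A)
  : Prop :=
  f ∘ e = g ∘ e /\
  forall (X : C) (h : hom X A), f ∘ h = g ∘ h -> exists! k : hom X E, e ∘ k = h.

Definition has_equalizers (C : Category) : Prop :=
  forall (A B : C) (f g : hom A B),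
    exists (E : C) (e : hom E A), is_equalizer f g e.

Definition preserves_equalizers (C D : Category) (F : Functor C D) : Prop :=
  forall (A B E : C) (f g : hom A B) (e : hom E A),
    is_equalizer f g e -> is_equalizer (fmap F f) (fmap F g) (fmap F e).

Definition is_coproduct (C : Category) (I : Type) (A : I -> C) (S : C)
  (inj : forall i, hom (A i) S) : Prop :=
  forall (B : C) (f : forall i, hom (A i) B),
    exists! h : hom S B, forall i, h ∘ inj i = f i.

(** The universe of the index types is independent of those of [C]. *)
Definition has_coproducts (C : Category) : Prop :=
  forall (I : Type) (A : I -> C),
    exists (S : C) (inj : forall i, hom (A i) S), is_coproduct inj.

Definition is_cartesian (E B : Category) (p : Functor E B) (A' A : E)
  (g : hom A' A) : Prop :=
  forall (X : E) (h : hom X A) (k : hom (p X) (p A')),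
    fmap p g ∘ k = fmap p h ->
    exists! l : hom X A', fmap p l = k /\ g ∘ l = h.

Definition is_fibration (E B : Category) (p : Functor E B) : Prop :=
  forall (A : E) (b : B) (f : hom b (p A)),
    exists (A' : E) (g : hom A' A) (e : p A' = b),
      eq_rect (p A') (fun x => hom x (p A)) (fmap p g) b e = f
      /\ is_cartesian p g.

Record Bicategory : Type := {
  cell0 :> Type;
  homcat : cell0 -> cell0 -> Category;
  id1 : forall X, homcat X X;
  comp1 : forall X Y Z, homcat Y Z -> homcat X Y -> homcat X Z;
  comp2 : forall X Y Z (G G' : homcat Y Z) (F F' : homcat X Y),
    hom G G' -> hom F F' -> hom (comp1 G F) (comp1 G' F');
  comp2_id : forall X Y Z (G : homcat Y Z) (F : homcat X Y),
    comp2 (idm G) (idm F) = idm (comp1 G F);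
  comp2_comp : forall X Y Z (G G' G'' : homcat Y Z) (F F' F'' : homcat X Y)
    (b' : hom G' G'') (b : hom G G') (a' : hom F' F'') (a : hom F F'),
    comp2 (b' ∘ b) (a' ∘ a) = comp2 b' a' ∘ comp2 b a;
  asc : forall X Y Z W (H : homcat Z W) (G : homcat Y Z) (F : homcat X Y),
    hom (comp1 H (comp1 G F)) (comp1 (comp1 H G) F);
  asc_inv : forall X Y Z W (H : homcat Z W) (G : homcat Y Z) (F : homcat X Y),
    hom (comp1 (comp1 H G) F) (comp1 H (comp1 G F));
  asc_invl : forall X Y Z W (H : homcat Z W) (G : homcat Y Z) (F : homcat X Y),
    asc_inv H G F ∘ asc H G F = idm _;
  asc_invr : forall X Y Z W (H : homcat Z W) (G : homcat Y Z) (F : homcat X Y),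
    asc H G F ∘ asc_inv H G F = idm _;
  asc_nat : forall X Y Z W (H H' : homcat Z W) (G G' : homcat Y Z)
    (F F' : homcat X Y) (c : hom H H') (b : hom G G') (a : hom F F'),
    asc H' G' F' ∘ comp2 c (comp2 b a) = comp2 (comp2 c b) a ∘ asc H G F;
  lun : forall X Y (F : homcat X Y), hom (comp1 (id1 Y) F) F;
  lun_inv : forall X Y (F : homcat X Y), hom F (comp1 (id1 Y) F);
  lun_invl : forall X Y (F : homcat X Y), lun_inv F ∘ lun F = idm _;
  lun_invr : forall X Y (F : homcat X Y), lun F ∘ lun_inv F = idm _;
  lun_nat : forall X Y (F F' : homcat X Y) (a : hom F F'),
    lun F' ∘ comp2 (idm (id1 Y)) a = a ∘ lun F;
  run : forall X Y (F : homcat X Y), hom (comp1 F (id1 X)) F;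
  run_inv : forall X Y (F : homcat X Y), hom F (comp1 F (id1 X));
  run_invl : forall X Y (F : homcat X Y), run_inv F ∘ run F = idm _;
  run_invr : forall X Y (F : homcat X Y), run F ∘ run_inv F = idm _;
  run_nat : forall X Y (F F' : homcat X Y) (a : hom F F'),
    run F' ∘ comp2 a (idm (id1 X)) = a ∘ run F;
  pentagon : forall X Y Z W V (K : homcat W V) (H : homcat Z W)
    (G : homcat Y Z) (F : homcat X Y),
    asc (comp1 K H) G F ∘ asc K H (comp1 G F)
    = comp2 (asc K H G) (idm F) ∘ asc K (comp1 H G) F
      ∘ comp2 (idm K) (asc H G F);
  triangle : forall X Y Z (G : homcat Y Z) (F : homcat X Y),
    comp2 (run G) (idm F) ∘ asc G (id1 Y) F = comp2 (idm G) (lun F)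
}.
Arguments id1 {_} X.

Notation "G ⊙ F" := (comp1 G F) (at level 35, right associativity).
Notation "b ⋆ a" := (comp2 b a) (at level 38, right associativity).

Definition has_local_coproducts (K : Bicategory) : Prop :=
  forall X Y : K, has_coproducts (homcat X Y).

Section Endomorphisms.
Variable K : Bicategory.

Record Endo : Type := MkEndo { carrier : K; endo : homcat carrier carrier }.

Record EndMap (A B : Endo) : Type := MkEndMap {
  emap : homcat (carrier A) (carrier B);
  ecell : hom (endo B ⊙ emap) (emap ⊙ endo A)
}.

Record EndCell (A B : Endo) (f f' : EndMap A B) : Type := MkEndCell {
  ec :> hom (emap f) (emap f');
  ec_eq : (ec ⋆ idm (endo A)) ∘ ecell f = ecell f' ∘ (idm (endo B) ⋆ ec)
}.

Lemma EndCell_eq (A B : Endo) (f f' : EndMap A B) (a b : EndCell f f') :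
  ec a = ec b -> a = b.
Proof.
destruct a as [a ea], b as [b eb]. simpl. intros E. subst b.
f_equal. apply proof_irrelevance.
Qed.

Definition EndCell_id (A B : Endo) (f : EndMap A B) : EndCell f f.
Proof.
refine {| ec := idm (emap f) |}.
rewrite !comp2_id, comp_idl, comp_idr. reflexivity.
Defined.

Definition EndCell_comp (A B : Endo) (f f' f'' : EndMap A B)
  (b : EndCell f' f'') (a : EndCell f f') : EndCell f f''.
Proof.
refine {| ec := ec b ∘ ec a |}.
rewrite <- (comp_idl (idm (endo A))), <- (comp_idl (idm (endo B))).
rewrite !comp2_comp, <- comp_assoc, (ec_eq a), comp_assoc, (ec_eq b).
rewrite <- comp_assoc. reflexivity.
Defined.

Definition End_cat (A B : Endo) : Category.
Proof.
refine {| obj := EndMap A B; hom := @EndCell A B;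
          idm := @EndCell_id A B; comp := @EndCell_comp A B |}.
- intros f g a. apply EndCell_eq, comp_idl.
- intros f g a. apply EndCell_eq, comp_idr.
- intros f g h k c b a. apply EndCell_eq, comp_assoc.
Defined.

Definition EndMap_id (A : Endo) : EndMap A A :=
  {| emap := id1 (carrier A); ecell := lun_inv (endo A) ∘ run (endo A) |}.

Definition EndMap_comp (A B C : Endo) (g : EndMap B C) (f : EndMap A B)
  : EndMap A C :=
  {| emap := emap g ⊙ emap f;
     ecell := asc (emap g) (emap f) (endo A)
              ∘ (idm (emap g) ⋆ ecell f)
              ∘ asc_inv (emap g) (endo B) (emap f)
              ∘ (ecell g ⋆ idm (emap f))
              ∘ asc (endo C) (emap g) (emap f) |}.

Record MonadStr (A : Endo) : Type := {
  mu : hom (endo A ⊙ endo A) (endo A);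
  eta : hom (id1 (carrier A)) (endo A);
  mu_assoc : mu ∘ (mu ⋆ idm (endo A)) ∘ asc (endo A) (endo A) (endo A)
             = mu ∘ (idm (endo A) ⋆ mu);
  mu_unitl : mu ∘ (eta ⋆ idm (endo A)) = lun (endo A);
  mu_unitr : mu ∘ (idm (endo A) ⋆ eta) = run (endo A)
}.

Record Monad : Type := MkMonad { mendo :> Endo; mstr : MonadStr mendo }.

Record MonadMap (M N : Monad) : Type := MkMonadMap {
  mmap :> EndMap M N;
  mmap_mu :
    ecell mmap ∘ (mu (mstr N) ⋆ idm (emap mmap))
    = (idm (emap mmap) ⋆ mu (mstr M))
      ∘ asc_inv (emap mmap) (endo M) (endo M)
      ∘ (ecell mmap ⋆ idm (endo M))
      ∘ asc (endo N) (emap mmap) (endo M)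
      ∘ (idm (endo N) ⋆ ecell mmap)
      ∘ asc_inv (endo N) (endo N) (emap mmap);
  mmap_eta :
    ecell mmap ∘ (eta (mstr N) ⋆ idm (emap mmap))
    = (idm (emap mmap) ⋆ eta (mstr M)) ∘ run_inv (emap mmap) ∘ lun (emap mmap)
}.

Definition Mnd_cat (M N : Monad) : Category :=
  induced_cat (fun f : MonadMap M N => mmap f : End_cat M N).

Definition Mnd_forget (M N : Monad) : Functor (Mnd_cat M N) (End_cat M N) :=
  induced_functor (fun f : MonadMap M N => mmap f : End_cat M N).

(** Composition with the endomorphism map [(1_Y, i) : (Y,S) -> (Y,Q)].
    In a bicategory the composite has underlying 1-cell [1_Y ⊙ F]; it is
    transported along [1_Y ⊙ F ≅ F], so that the functor commutes strictly
    with the forgetful functors to [homcat X Y]. *)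
Section Postcomposition.
Variables (A : Endo) (Y : K) (Q S : homcat Y Y) (i : hom Q S).

Definition postcomp_map (f : EndMap A (MkEndo S)) : EndMap A (MkEndo Q) :=
  @MkEndMap A (MkEndo Q) (emap f) (ecell f ∘ (i ⋆ idm (emap f))).

Definition postcomp_cell (f g : EndMap A (MkEndo S)) (a : EndCell f g)
  : EndCell (postcomp_map f) (postcomp_map g).
Proof.
refine (@MkEndCell A (MkEndo Q) (postcomp_map f) (postcomp_map g) (ec a) _).
pose proof (ec_eq a) as E. simpl in *.
rewrite comp_assoc, E, <- !comp_assoc. f_equal.
rewrite <- !comp2_comp, !comp_idl, !comp_idr. reflexivity.
Defined.

Definition postcomp : Functor (End_cat A (MkEndo S)) (End_cat A (MkEndo Q)).
Proof.
refine (@Build_Functor (End_cat A (MkEndo S)) (End_cat A (MkEndo Q))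
          postcomp_map postcomp_cell _ _).
- intros f. apply EndCell_eq. reflexivity.
- intros f g h b a. apply EndCell_eq. reflexivity.
Defined.

End Postcomposition.

Definition is_free_monad (Y : K) (Q S : homcat Y Y) (m : MonadStr (MkEndo S))
  (i : hom Q S) : Prop :=
  forall M : Monad,
    is_isomorphism_of_categories
      (comp_functor (postcomp M i) (Mnd_forget M (MkMonad m))).

Definition admits_free_monads : Prop :=
  forall (Y : K) (Q : homcat Y Y),
    exists (S : homcat Y Y) (m : MonadStr (MkEndo S)) (i : hom Q S),
      is_free_monad m i.

End Endomorphisms.

(** Squares are indexed by their top and bottom sides only; the vertical sides
    are the functions [bd0] (left) and [bd1] (right).  This way vertical
    composition is strict without transports along equations between vertical
    arrows; horizontal composition [hsq b a e] instead takes a proof [e] that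
    the shared sides agree.  The axioms involving [hsq] are stated for all such
    proofs. *)
Record DoubleCat : Type := {
  C0 :> Category;
  hor : C0 -> C0 -> Type;
  sq : forall X Y X' Y' : C0, hor X Y -> hor X' Y' -> Type;
  sqid : forall (X Y : C0) (F : hor X Y), sq F F;
  sqcomp : forall (X Y X' Y' X'' Y'' : C0)
    (F : hor X Y) (F' : hor X' Y') (F'' : hor X'' Y''),
    sq F' F'' -> sq F F' -> sq F F'';
  sqcomp_idl : forall (X Y X' Y' : C0) (F : hor X Y) (F' : hor X' Y')
    (a : sq F F'), sqcomp (sqid F') a = a;
  sqcomp_idr : forall (X Y X' Y' : C0) (F : hor X Y) (F' : hor X' Y')
    (a : sq F F'), sqcomp a (sqid F) = a;
  sqcomp_assoc : forall (X Y X' Y' X'' Y'' X3 Y3 : C0)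
    (F : hor X Y) (F' : hor X' Y') (F'' : hor X'' Y'') (F3 : hor X3 Y3)
    (c : sq F'' F3) (b : sq F' F'') (a : sq F F'),
    sqcomp c (sqcomp b a) = sqcomp (sqcomp c b) a;
  bd0 : forall (X Y X' Y' : C0) (F : hor X Y) (F' : hor X' Y'),
    sq F F' -> hom X X';
  bd1 : forall (X Y X' Y' : C0) (F : hor X Y) (F' : hor X' Y'),
    sq F F' -> hom Y Y';
  bd0_id : forall (X Y : C0) (F : hor X Y), bd0 (sqid F) = idm X;
  bd1_id : forall (X Y : C0) (F : hor X Y), bd1 (sqid F) = idm Y;
  bd0_comp : forall (X Y X' Y' X'' Y'' : C0)
    (F : hor X Y) (F' : hor X' Y') (F'' : hor X'' Y'')
    (b : sq F' F'') (a : sq F F'), bd0 (sqcomp b a) = bd0 b ∘ bd0 a;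
  bd1_comp : forall (X Y X' Y' X'' Y'' : C0)
    (F : hor X Y) (F' : hor X' Y') (F'' : hor X'' Y'')
    (b : sq F' F'') (a : sq F F'), bd1 (sqcomp b a) = bd1 b ∘ bd1 a;
  hid : forall X : C0, hor X X;
  hidsq : forall (X X' : C0) (u : hom X X'), sq (hid X) (hid X');
  bd0_hidsq : forall (X X' : C0) (u : hom X X'), bd0 (hidsq u) = u;
  bd1_hidsq : forall (X X' : C0) (u : hom X X'), bd1 (hidsq u) = u;
  hidsq_id : forall X : C0, hidsq (idm X) = sqid (hid X);
  hidsq_comp : forall (X X' X'' : C0) (v : hom X' X'') (u : hom X X'),
    hidsq (v ∘ u) = sqcomp (hidsq v) (hidsq u);
  hcomp : forall X Y Z : C0, hor Y Z -> hor X Y -> hor X Z;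
  hsq : forall (X Y Z X' Y' Z' : C0) (G : hor Y Z) (G' : hor Y' Z')
    (F : hor X Y) (F' : hor X' Y') (b : sq G G') (a : sq F F'),
    bd1 a = bd0 b -> sq (hcomp G F) (hcomp G' F');
  bd0_hsq : forall (X Y Z X' Y' Z' : C0) (G : hor Y Z) (G' : hor Y' Z')
    (F : hor X Y) (F' : hor X' Y') (b : sq G G') (a : sq F F')
    (e : bd1 a = bd0 b), bd0 (hsq e) = bd0 a;
  bd1_hsq : forall (X Y Z X' Y' Z' : C0) (G : hor Y Z) (G' : hor Y' Z')
    (F : hor X Y) (F' : hor X' Y') (b : sq G G') (a : sq F F')
    (e : bd1 a = bd0 b), bd1 (hsq e) = bd1 b;
  hsq_id : forall (X Y Z : C0) (G : hor Y Z) (F : hor X Y)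
    (e : bd1 (sqid F) = bd0 (sqid G)), hsq e = sqid (hcomp G F);
  interchange : forall (X Y Z X' Y' Z' X'' Y'' Z'' : C0)
    (G : hor Y Z) (G' : hor Y' Z') (G'' : hor Y'' Z'')
    (F : hor X Y) (F' : hor X' Y') (F'' : hor X'' Y'')
    (b' : sq G' G'') (b : sq G G') (a' : sq F' F'') (a : sq F F')
    (e : bd1 a = bd0 b) (e' : bd1 a' = bd0 b')
    (e'' : bd1 (sqcomp a' a) = bd0 (sqcomp b' b)),
    hsq e'' = sqcomp (hsq e') (hsq e);
  hasc : forall (X Y Z W : C0) (H : hor Z W) (G : hor Y Z) (F : hor X Y),
    sq (hcomp H (hcomp G F)) (hcomp (hcomp H G) F);
  hasc_inv : forall (X Y Z W : C0) (H : hor Z W) (G : hor Y Z) (F : hor X Y),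
    sq (hcomp (hcomp H G) F) (hcomp H (hcomp G F));
  bd0_hasc : forall (X Y Z W : C0) (H : hor Z W) (G : hor Y Z) (F : hor X Y),
    bd0 (hasc H G F) = idm X;
  bd1_hasc : forall (X Y Z W : C0) (H : hor Z W) (G : hor Y Z) (F : hor X Y),
    bd1 (hasc H G F) = idm W;
  hasc_invl : forall (X Y Z W : C0) (H : hor Z W) (G : hor Y Z) (F : hor X Y),
    sqcomp (hasc_inv H G F) (hasc H G F) = sqid _;
  hasc_invr : forall (X Y Z W : C0) (H : hor Z W) (G : hor Y Z) (F : hor X Y),
    sqcomp (hasc H G F) (hasc_inv H G F) = sqid _;
  hasc_nat : forall (X Y Z W X' Y' Z' W' : C0)
    (H : hor Z W) (H' : hor Z' W') (G : hor Y Z) (G' : hor Y' Z')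
    (F : hor X Y) (F' : hor X' Y')
    (c : sq H H') (b : sq G G') (a : sq F F')
    (e1 : bd1 a = bd0 b) (e2 : bd1 b = bd0 c)
    (e3 : bd1 (hsq e1) = bd0 c) (e4 : bd1 a = bd0 (hsq e2)),
    sqcomp (hasc H' G' F') (hsq e3) = sqcomp (hsq e4) (hasc H G F);
  hlun : forall (X Y : C0) (F : hor X Y), sq (hcomp (hid Y) F) F;
  hlun_inv : forall (X Y : C0) (F : hor X Y), sq F (hcomp (hid Y) F);
  bd0_hlun : forall (X Y : C0) (F : hor X Y), bd0 (hlun F) = idm X;
  bd1_hlun : forall (X Y : C0) (F : hor X Y), bd1 (hlun F) = idm Y;
  hlun_invl : forall (X Y : C0) (F : hor X Y),
    sqcomp (hlun_inv F) (hlun F) = sqid _;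
  hlun_invr : forall (X Y : C0) (F : hor X Y),
    sqcomp (hlun F) (hlun_inv F) = sqid _;
  hlun_nat : forall (X Y X' Y' : C0) (F : hor X Y) (F' : hor X' Y')
    (a : sq F F') (e : bd1 a = bd0 (hidsq (bd1 a))),
    sqcomp (hlun F') (hsq e) = sqcomp a (hlun F);
  hrun : forall (X Y : C0) (F : hor X Y), sq (hcomp F (hid X)) F;
  hrun_inv : forall (X Y : C0) (F : hor X Y), sq F (hcomp F (hid X));
  bd0_hrun : forall (X Y : C0) (F : hor X Y), bd0 (hrun F) = idm X;
  bd1_hrun : forall (X Y : C0) (F : hor X Y), bd1 (hrun F) = idm Y;
  hrun_invl : forall (X Y : C0) (F : hor X Y),
    sqcomp (hrun_inv F) (hrun F) = sqid _;
  hrun_invr : forall (X Y : C0) (F : hor X Y),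
    sqcomp (hrun F) (hrun_inv F) = sqid _;
  hrun_nat : forall (X Y X' Y' : C0) (F : hor X Y) (F' : hor X' Y')
    (a : sq F F') (e : bd1 (hidsq (bd0 a)) = bd0 a),
    sqcomp (hrun F') (hsq e) = sqcomp a (hrun F);
  hpentagon : forall (X Y Z W V : C0)
    (K : hor W V) (H : hor Z W) (G : hor Y Z) (F : hor X Y)
    (e : bd1 (sqid F) = bd0 (hasc K H G))
    (e' : bd1 (hasc H G F) = bd0 (sqid K)),
    sqcomp (hasc (hcomp K H) G F) (hasc K H (hcomp G F))
    = sqcomp (sqcomp (hsq e) (hasc K (hcomp H G) F)) (hsq e');
  htriangle : forall (X Y Z : C0) (G : hor Y Z) (F : hor X Y)
    (e : bd1 (sqid F) = bd0 (hrun G)) (e' : bd1 (hlun F) = bd0 (sqid G)),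
    sqcomp (hsq e) (hasc G (hid Y) F) = hsq e'
}.
Arguments hsq {_ X Y Z X' Y' Z' G G' F F'} b a _.
Arguments hid {_} X.
Arguments hidsq {_ X X'} u.
Arguments sqid {_ X Y} F.

Notation "b ∘s a" := (sqcomp b a) (at level 40, left associativity).

Section DoubleCategories.
Variable C : DoubleCat.

Record HArrow : Type := MkHArrow {
  hsrc : C; htgt : C; harr : hor hsrc htgt
}.

Definition C1 : Category :=
  {| obj := HArrow;
     hom := fun F G => sq (harr F) (harr G);
     idm := fun F => sqid (harr F);
     comp := fun F G H b a => b ∘s a;
     comp_idl := fun F G a => sqcomp_idl a;
     comp_idr := fun F G a => sqcomp_idr a;
     comp_assoc := fun F G H L c b a => sqcomp_assoc c b a |}.

Definition d0 : Functor C1 C :=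
  {| fob := hsrc : C1 -> C;
     fmap := fun (F G : C1) (a : hom F G) => bd0 a;
     fmap_id := fun F => bd0_id (harr F);
     fmap_comp := fun F G H b a => bd0_comp b a |}.

Definition d1 : Functor C1 C :=
  {| fob := htgt : C1 -> C;
     fmap := fun (F G : C1) (a : hom F G) => bd1 a;
     fmap_id := fun F => bd1_id (harr F);
     fmap_comp := fun F G H b a => bd1_comp b a |}.

Definition is_framed_bicategory : Prop := is_fibration (pair_functor d0 d1).

Record Globular (X Y : C) (F F' : hor X Y) : Type := MkGlobular {
  gsq :> sq F F';
  gsq0 : bd0 gsq = idm X;
  gsq1 : bd1 gsq = idm Y
}.

Lemma Globular_eq (X Y : C) (F F' : hor X Y) (a b : Globular F F') :
  gsq a = gsq b -> a = b.
Proof.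
destruct a as [a p q], b as [b p' q']. simpl. intros E. subst b.
f_equal; apply proof_irrelevance.
Qed.

Lemma hsq_congr (X Y Z X' Y' Z' : C) (G : hor Y Z) (G' : hor Y' Z')
  (F : hor X Y) (F' : hor X' Y') (b b' : sq G G') (a a' : sq F F')
  (e : bd1 a = bd0 b) (e' : bd1 a' = bd0 b') :
  b = b' -> a = a' -> hsq b a e = hsq b' a' e'.
Proof.
intros E1 E2. subst b' a'. f_equal. apply proof_irrelevance.
Qed.

Lemma bd0_inverse (X Y : C) (F F' : hor X Y) (a : sq F F') (b : sq F' F) :
  bd0 a = idm X -> b ∘s a = sqid F -> bd0 b = idm X.
Proof.
intros E E'. pose proof (f_equal (fun s => bd0 s) E') as B. simpl in B.
rewrite bd0_comp, E, comp_idr, bd0_id in B. exact B.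
Qed.

Lemma bd1_inverse (X Y : C) (F F' : hor X Y) (a : sq F F') (b : sq F' F) :
  bd1 a = idm Y -> b ∘s a = sqid F -> bd1 b = idm Y.
Proof.
intros E E'. pose proof (f_equal (fun s => bd1 s) E') as B. simpl in B.
rewrite bd1_comp, E, comp_idr, bd1_id in B. exact B.
Qed.

Definition Globular_id (X Y : C) (F : hor X Y) : Globular F F :=
  {| gsq := sqid F; gsq0 := bd0_id F; gsq1 := bd1_id F |}.

Definition Globular_comp (X Y : C) (F F' F'' : hor X Y)
  (b : Globular F' F'') (a : Globular F F') : Globular F F''.
Proof.
refine {| gsq := gsq b ∘s gsq a |}.
- rewrite bd0_comp, (gsq0 b), (gsq0 a). apply comp_idl.
- rewrite bd1_comp, (gsq1 b), (gsq1 a). apply comp_idl.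
Defined.

Definition Globular_hcomp (X Y Z : C) (G G' : hor Y Z) (F F' : hor X Y)
  (b : Globular G G') (a : Globular F F')
  : Globular (hcomp G F) (hcomp G' F') :=
  {| gsq := hsq (gsq b) (gsq a) (eq_trans (gsq1 a) (eq_sym (gsq0 b)));
     gsq0 := eq_trans (bd0_hsq _) (gsq0 a);
     gsq1 := eq_trans (bd1_hsq _) (gsq1 b) |}.

Definition Hcat (X Y : C) : Category.
Proof.
refine {| obj := hor X Y; hom := @Globular X Y;
          idm := @Globular_id X Y; comp := @Globular_comp X Y |}.
- intros F F' a. apply Globular_eq, sqcomp_idl.
- intros F F' a. apply Globular_eq, sqcomp_idr.
- intros F F' F'' F3 c b a. apply Globular_eq, sqcomp_assoc.
Defined.

Definition horizontal_bicat : Bicategory.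
Proof.
refine {|
  cell0 := C : Type;
  homcat := Hcat;
  id1 := fun X => hid X : Hcat X X;
  comp1 := fun X Y Z (G : Hcat Y Z) (F : Hcat X Y) => hcomp G F : Hcat X Z;
  comp2 := fun X Y Z (G G' : Hcat Y Z) (F F' : Hcat X Y)
    (b : hom G G') (a : hom F F') => Globular_hcomp b a;
  asc := fun X Y Z W (H : Hcat Z W) (G : Hcat Y Z) (F : Hcat X Y) =>
    MkGlobular (bd0_hasc H G F) (bd1_hasc H G F);
  asc_inv := fun X Y Z W (H : Hcat Z W) (G : Hcat Y Z) (F : Hcat X Y) =>
    MkGlobular (bd0_inverse (bd0_hasc H G F) (hasc_invl H G F))
               (bd1_inverse (bd1_hasc H G F) (hasc_invl H G F));
  lun := fun X Y (F : Hcat X Y) => MkGlobular (bd0_hlun F) (bd1_hlun F);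
  lun_inv := fun X Y (F : Hcat X Y) =>
    MkGlobular (bd0_inverse (bd0_hlun F) (hlun_invl F))
               (bd1_inverse (bd1_hlun F) (hlun_invl F));
  run := fun X Y (F : Hcat X Y) => MkGlobular (bd0_hrun F) (bd1_hrun F);
  run_inv := fun X Y (F : Hcat X Y) =>
    MkGlobular (bd0_inverse (bd0_hrun F) (hrun_invl F))
               (bd1_inverse (bd1_hrun F) (hrun_invl F))
|}; intros; apply Globular_eq; simpl.
- apply hsq_id.
- apply interchange.
- apply hasc_invl.
- apply hasc_invr.
- apply hasc_nat.
- apply hlun_invl.
- apply hlun_invr.
- assert (e : bd1 a = bd0 (hidsq (bd1 a))) by (rewrite bd0_hidsq; reflexivity).
  rewrite <- (hlun_nat e). f_equal. apply hsq_congr; [|reflexivity].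
  rewrite (gsq1 a). symmetry. apply hidsq_id.
- apply hrun_invl.
- apply hrun_invr.
- assert (e : bd1 (hidsq (bd0 a)) = bd0 a) by (rewrite bd1_hidsq; reflexivity).
  rewrite <- (hrun_nat e). f_equal. apply hsq_congr; [reflexivity|].
  rewrite (gsq0 a). symmetry. apply hidsq_id.
- apply hpentagon.
- apply htriangle.
Defined.

Local Notation HC := horizontal_bicat.

Definition cell_sq (X Y : HC) (F F' : homcat X Y) (a : hom F F') : sq F F' :=
  gsq a.

(** The objects and horizontal arrows of the double categories End(C) and
    Mnd(C) are [Endo HC], [EndMap], [Monad HC] and [MonadMap]. *)

Record VEndMap (A B : Endo HC) : Type := MkVEndMap {
  vmap : @hom C (carrier A) (carrier B);
  vsq : sq (endo A) (endo B);
  vsq0 : bd0 vsq = vmap;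
  vsq1 : bd1 vsq = vmap
}.

Definition VEndMap_comp (A B D : Endo HC) (v : VEndMap B D) (u : VEndMap A B)
  : VEndMap A D.
Proof.
refine {| vmap := vmap v ∘ vmap u; vsq := vsq v ∘s vsq u |}.
- rewrite bd0_comp, (vsq0 v), (vsq0 u). reflexivity.
- rewrite bd1_comp, (vsq1 v), (vsq1 u). reflexivity.
Defined.

Record VMonadMap (M N : Monad HC) : Type := MkVMonadMap {
  vmnd :> VEndMap M N;
  vmnd_mu :
    vsq vmnd ∘s cell_sq (mu (mstr M))
    = cell_sq (mu (mstr N))
      ∘s hsq (vsq vmnd) (vsq vmnd) (eq_trans (vsq1 vmnd) (eq_sym (vsq0 vmnd)));
  vmnd_eta :
    vsq vmnd ∘s cell_sq (eta (mstr M))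
    = cell_sq (eta (mstr N)) ∘s hidsq (vmap vmnd)
}.

(** Top [f], bottom [f'], left [u], right [v].  Squares of Mnd(C) are the
    [EndSquare]s between the underlying endomorphism maps. *)
Record EndSquare (A B A' B' : Endo HC) (f : EndMap A B) (f' : EndMap A' B')
  (u : VEndMap A A') (v : VEndMap B B') : Type := MkEndSquare {
  esq :> sq (emap f) (emap f');
  esq0 : bd0 esq = vmap u;
  esq1 : bd1 esq = vmap v;
  esq_eq :
    hsq esq (vsq u) (eq_trans (vsq1 u) (eq_sym esq0)) ∘s cell_sq (ecell f)
    = cell_sq (ecell f')
      ∘s hsq (vsq v) esq (eq_trans esq1 (eq_sym (vsq0 v)))
}.

Definition cast_bottom (X Y X' Y' : C) (F : hor X Y) (F' F'' : hor X' Y')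
  (e : F' = F'') (a : sq F F') : sq F F'' :=
  eq_rect F' (fun G => sq F G) a F'' e.

(** A left adjoint to the forgetful double functor Mnd(C) -> End(C) in the
    2-category of double categories, double functors and vertical
    transformations, given by its action on objects and horizontal arrows and
    by the universal property of its unit. *)
Record FreeMonads : Type := {
  star : Endo HC -> Monad HC;
  iota : forall A : Endo HC, VEndMap A (star A);
  sharp : forall (A : Endo HC) (M : Monad HC),
    VEndMap A M -> VMonadMap (star A) M;
  sharp_iota : forall (A : Endo HC) (M : Monad HC) (u : VEndMap A M),
    VEndMap_comp (sharp u) (iota A) = u;
  sharp_unique : forall (A : Endo HC) (M : Monad HC) (u : VEndMap A M)
    (w : VMonadMap (star A) M), VEndMap_comp w (iota A) = u -> w = sharp u;
  hstar : forall A B : Endo HC, EndMap A B -> MonadMap (star A) (star B);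
  iota_sq : forall (A B : Endo HC) (f : EndMap A B),
    EndSquare f (hstar f) (iota A) (iota B);
  iota_sq_universal : forall (A B : Endo HC) (f : EndMap A B) (M N : Monad HC)
    (f' : MonadMap M N) (u : VEndMap A M) (v : VEndMap B N)
    (a : EndSquare f f' u v),
    exists! b : EndSquare (hstar f) f' (sharp u) (sharp v),
      esq b ∘s esq (iota_sq f) = esq a;
  hstar_id : forall A : Endo HC,
    mmap (hstar (EndMap_id A)) = EndMap_id (star A);
  hstar_comp : forall (A B D : Endo HC) (g : EndMap B D) (f : EndMap A B),
    mmap (hstar (EndMap_comp g f)) = EndMap_comp (hstar g) (hstar f);
  iota_sq_id : forall A : Endo HC,
    cast_bottom (f_equal (@emap HC _ _) (hstar_id A)) (iota_sq (EndMap_id A))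
    = hidsq (vmap (iota A));
  iota_sq_comp : forall (A B D : Endo HC) (g : EndMap B D) (f : EndMap A B),
    cast_bottom (f_equal (@emap HC _ _) (hstar_comp g f))
      (iota_sq (EndMap_comp g f))
    = hsq (iota_sq g) (iota_sq f)
        (eq_trans (esq1 (iota_sq f)) (eq_sym (esq0 (iota_sq g))))
}.

Definition double_admits_free_monads : Prop := inhabited FreeMonads.

End DoubleCategories.

(* Main.v *)
From Stdlib Require Import ProofIrrelevance ClassicalEpsilon.
Require Import Defs.

(** The free monad on an endomorphism [(X,P)] is the free monad [(X,S)] of the
    horizontal bicategory, with its unit [i : P -> S]; the unit of the adjunction
    is the identity on objects, and on horizontal arrows it is an identity
    square.  So the left adjoint leaves objects and horizontal arrows unchanged,
    and three things have to be shown.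

    Vertical universal property ([vertical_extension]).  The freeness of [S] is
    a statement about horizontal maps, but the maps whose 1-cell is an identity
    are the morphisms of monoids [S -> R] between monads on one and the same
    object, so these correspond to cells [P -> R] ([free_monad_monoid]).  A
    vertical map over [u : X -> X'] from [P] to a monad [P'] becomes such a cell
    once [P'] is replaced by its restriction [R] along [u], the source of a
    cartesian square [R => P'] over [(u,u)]: cartesianness carries the monad
    structure of [P'] back to [R] ([restriction_monad]).

    Horizontal arrows ([free_map]).  Let [(Y,T)] be the free monad on [(Y,Q)].
    Given [phi : QF => FP], the cell [(F i) phi : QF => FS] makes [F] a map from
    the monad [S] to the endomorphism [Q], so it extends to a unique monad map
    [c : TF => FS].  Functoriality follows from uniqueness, because identities
    and composites of monad maps are monad maps ([identity_laws],
    [mu_law_comp]).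

    Squares ([endomorphism_square_extends]).  An endomorphism square [alpha]
    into monad maps with vertical sides [u] and [v] has to be compatible with
    the extensions of the sides to the free monads.  This says that two squares
    [TF => F'P'] with the same sides are equal.  Both are compatible with the
    actions of [Q] on [TF] and of [Q'] on [F'P'], and they agree after the unit
    [F => TF].  An equalizer of the two squares has invertible sides, since
    [d0] and [d1] preserve it; restricting along the inverses of the sides
    makes it a globular cell [E => TF] ([globular_weak_equalizer]).  Then [E] is
    a [Q]-subalgebra of [TF] that contains the unit.  Since [TF] is the free
    [Q]-algebra on [F], the cell [E => TF] has a section
    ([free_algebra_induction]), and the two squares coincide. *)

Set Implicit Arguments.
Unset Strict Implicit.
Unset Printing Implicit Defensive.

(** * Rewriting modulo associativity *)

Lemma precomp_eq (C : Category) (A B D E : C) (f : hom B D) (g : hom A B)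
  (h : hom A D) (k : hom E A) : f ∘ g = h -> f ∘ (g ∘ k) = h ∘ k.
Proof. intros <-. apply comp_assoc. Qed.

Lemma cancel_l (C : Category) (A B E : C) (r : hom B A) (s : hom A B)
  (a b : hom E A) : r ∘ s = idm A -> s ∘ a = s ∘ b -> a = b.
Proof.
intros I E1. rewrite <- (comp_idl a), <- (comp_idl b), <- I.
rewrite <- !comp_assoc, E1. reflexivity.
Qed.

Lemma cancel_r (C : Category) (A B E : C) (r : hom B A) (s : hom A B)
  (a b : hom A E) : r ∘ s = idm A -> a ∘ r = b ∘ r -> a = b.
Proof.
intros I E1. rewrite <- (comp_idr a), <- (comp_idr b), <- I.
rewrite !comp_assoc, E1. reflexivity.
Qed.

Ltac rassoc := repeat rewrite <- comp_assoc.

(** [rw H] rewrites with an equation between composites when its left-hand side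
    occurs as a segment of a composite bracketed to the right.  The number [n]
    bounds the number of arguments of [H] that are left to unification. *)
Ltac rw_post n H :=
  first
    [ rewrite (precomp_eq _ H)
    | lazymatch n with S ?m => let H' := uconstr:(H _) in rw_post m H' end ].

Ltac rwl_post n H :=
  first
    [ rewrite (precomp_eq _ (eq_sym H))
    | lazymatch n with S ?m => let H' := uconstr:(H _) in rwl_post m H' end ].

Tactic Notation "rw" uconstr(H) :=
  first [ rw_post 16 H | rewrite H ]; repeat rewrite <- comp_assoc.

Tactic Notation "rw" "<-" uconstr(H) :=
  first [ rwl_post 16 H | rewrite <- H ]; repeat rewrite <- comp_assoc.

Notation "G ◁ a" := (idm G ⋆ a) (at level 38, right associativity).
Notation "a ▷ F" := (a ⋆ idm F) (at level 37, left associativity).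

(** * Whiskering and coherence in a bicategory *)

Section Bicategory.
Variable K : Bicategory.

Lemma whisker_l_comp (X Y Z : K) (G : homcat Y Z) (F F' F'' : homcat X Y)
  (b : hom F' F'') (a : hom F F') : G ◁ (b ∘ a) = (G ◁ b) ∘ (G ◁ a).
Proof. rewrite <- comp2_comp, comp_idl. reflexivity. Qed.

Lemma whisker_r_comp (X Y Z : K) (G G' G'' : homcat Y Z) (F : homcat X Y)
  (b : hom G' G'') (a : hom G G') : (b ∘ a) ▷ F = (b ▷ F) ∘ (a ▷ F).
Proof. rewrite <- comp2_comp, comp_idl. reflexivity. Qed.

Lemma whisker_lr (X Y Z : K) (G G' : homcat Y Z) (F F' : homcat X Y)
  (b : hom G G') (a : hom F F') : b ⋆ a = (G' ◁ a) ∘ (b ▷ F).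
Proof. rewrite <- comp2_comp, comp_idl, comp_idr. reflexivity. Qed.

Lemma whisker_rl (X Y Z : K) (G G' : homcat Y Z) (F F' : homcat X Y)
  (b : hom G G') (a : hom F F') : b ⋆ a = (b ▷ F') ∘ (G ◁ a).
Proof. rewrite <- comp2_comp, comp_idl, comp_idr. reflexivity. Qed.

Lemma whisker_exchange (X Y Z : K) (G G' : homcat Y Z) (F F' : homcat X Y)
  (b : hom G G') (a : hom F F') : (b ▷ F') ∘ (G ◁ a) = (G' ◁ a) ∘ (b ▷ F).
Proof. rewrite <- whisker_lr. symmetry. apply whisker_rl. Qed.

Lemma asc_nat_l (X Y Z W : K) (H H' : homcat Z W) (G : homcat Y Z)
  (F : homcat X Y) (c : hom H H') :
  asc H' G F ∘ (c ▷ (G ⊙ F)) = (c ▷ G ▷ F) ∘ asc H G F.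
Proof. rewrite <- comp2_id. apply asc_nat. Qed.

Lemma asc_nat_m (X Y Z W : K) (H : homcat Z W) (G G' : homcat Y Z)
  (F : homcat X Y) (b : hom G G') :
  asc H G' F ∘ (H ◁ (b ▷ F)) = ((H ◁ b) ▷ F) ∘ asc H G F.
Proof. apply asc_nat. Qed.

Lemma asc_nat_r (X Y Z W : K) (H : homcat Z W) (G : homcat Y Z)
  (F F' : homcat X Y) (a : hom F F') :
  asc H G F' ∘ (H ◁ G ◁ a) = ((H ⊙ G) ◁ a) ∘ asc H G F.
Proof. rewrite asc_nat, comp2_id. reflexivity. Qed.

Lemma asc_inj_l (X Y Z W : K) (H : homcat Z W) (G : homcat Y Z)
  (F : homcat X Y) (E : homcat X W) (a b : hom E (H ⊙ (G ⊙ F))) :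
  asc H G F ∘ a = asc H G F ∘ b -> a = b.
Proof.
exact (cancel_l (asc_invl H G F)).
Qed.

Lemma asc_inj_r (X Y Z W : K) (H : homcat Z W) (G : homcat Y Z)
  (F : homcat X Y) (E : homcat X W) (a b : hom ((H ⊙ G) ⊙ F) E) :
  a ∘ asc H G F = b ∘ asc H G F -> a = b.
Proof.
exact (cancel_r (asc_invr H G F)).
Qed.

Lemma asc_inv_nat (X Y Z W : K) (H H' : homcat Z W) (G G' : homcat Y Z)
  (F F' : homcat X Y) (c : hom H H') (b : hom G G') (a : hom F F') :
  asc_inv H' G' F' ∘ ((c ⋆ b) ⋆ a) = (c ⋆ (b ⋆ a)) ∘ asc_inv H G F.
Proof.
apply asc_inj_l, asc_inj_r. rassoc.
rewrite asc_invl, comp_idr, asc_nat. rw asc_invr. rewrite comp_idl. reflexivity.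
Qed.

Lemma asc_inv_nat_l (X Y Z W : K) (H H' : homcat Z W) (G : homcat Y Z)
  (F : homcat X Y) (c : hom H H') :
  asc_inv H' G F ∘ (c ▷ G ▷ F) = (c ▷ (G ⊙ F)) ∘ asc_inv H G F.
Proof. rewrite <- comp2_id. apply asc_inv_nat. Qed.

Lemma asc_inv_nat_m (X Y Z W : K) (H : homcat Z W) (G G' : homcat Y Z)
  (F : homcat X Y) (b : hom G G') :
  asc_inv H G' F ∘ ((H ◁ b) ▷ F) = (H ◁ (b ▷ F)) ∘ asc_inv H G F.
Proof. apply asc_inv_nat. Qed.

Lemma asc_inv_nat_r (X Y Z W : K) (H : homcat Z W) (G : homcat Y Z)
  (F F' : homcat X Y) (a : hom F F') :
  asc_inv H G F' ∘ ((H ⊙ G) ◁ a) = (H ◁ G ◁ a) ∘ asc_inv H G F.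
Proof. rewrite <- comp2_id. apply asc_inv_nat. Qed.

Lemma lun_inj (X Y : K) (F F' : homcat X Y) (a b : hom F F') :
  id1 Y ◁ a = id1 Y ◁ b -> a = b.
Proof.
intros E. rewrite <- (comp_idr a), <- (comp_idr b), <- (lun_invr F).
rewrite !comp_assoc, <- !lun_nat, E. reflexivity.
Qed.

Lemma run_inj (X Y : K) (F F' : homcat X Y) (a b : hom F F') :
  a ▷ id1 X = b ▷ id1 X -> a = b.
Proof.
intros E. rewrite <- (comp_idr a), <- (comp_idr b), <- (run_invr F).
rewrite !comp_assoc, <- !run_nat, E. reflexivity.
Qed.

Lemma lun_inv_nat (X Y : K) (F F' : homcat X Y) (a : hom F F') :
  lun_inv F' ∘ a = (id1 Y ◁ a) ∘ lun_inv F.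
Proof.
rewrite <- (comp_idr (lun_inv F' ∘ a)), <- (lun_invr F). rassoc.
rw <- (lun_nat a). rw (lun_invl F'). rewrite comp_idl. reflexivity.
Qed.

Lemma run_inv_nat (X Y : K) (F F' : homcat X Y) (a : hom F F') :
  run_inv F' ∘ a = (a ▷ id1 X) ∘ run_inv F.
Proof.
rewrite <- (comp_idr (run_inv F' ∘ a)), <- (run_invr F). rassoc.
rw <- (run_nat a). rw (run_invl F'). rewrite comp_idl. reflexivity.
Qed.

(** The three unit coherences that Kelly derived from the pentagon and the
    triangle.  Whiskering with an identity 1-cell is faithful, so it suffices to
    prove them after whiskering; there the pentagon with two identities among
    its 1-cells reduces them to the triangle. *)
Lemma lun_comp1 (X Y Z : K) (G : homcat Y Z) (F : homcat X Y) :
  (lun G ▷ F) ∘ asc (id1 Z) G F = lun (G ⊙ F).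
Proof.
apply lun_inj, asc_inj_l. rewrite whisker_l_comp.
rw asc_nat_m. rewrite <- triangle, whisker_r_comp. rassoc.
rewrite (comp_assoc (asc (id1 Z) (id1 Z) G ▷ F)), <- pentagon.
rw <- asc_nat_l. rewrite triangle. reflexivity.
Qed.

Lemma run_comp1 (X Y Z : K) (G : homcat Y Z) (F : homcat X Y) :
  run (G ⊙ F) ∘ asc G F (id1 X) = G ◁ run F.
Proof.
apply run_inj. rewrite whisker_r_comp.
apply (@asc_inj_r _ _ _ _ G (F ⊙ id1 X) (id1 X)).
assert (I : (G ◁ asc F (id1 X) (id1 X)) ∘ (G ◁ asc_inv F (id1 X) (id1 X)) = idm _).
{ rewrite <- whisker_l_comp, asc_invr, comp2_id. reflexivity. }
rewrite <- (comp_idr (_ ∘ asc _ _ _)), <- I, <- (comp_idr ((G ◁ run F) ▷ id1 X ∘ _)), <- I.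
rewrite !comp_assoc. f_equal. rassoc.
rewrite (comp_assoc (asc G F (id1 X) ▷ id1 X)), <- pentagon.
rw triangle. rw <- asc_nat_m. rewrite <- whisker_l_comp, triangle.
rewrite asc_nat_r. reflexivity.
Qed.

Lemma lun_id1 (X : K) : lun (id1 X) = run (id1 X).
Proof.
apply run_inj. apply asc_inj_r. rewrite triangle, lun_comp1.
rewrite <- (comp_idl (lun _)), <- (comp_idl (idm _ ⋆ _)), <- (lun_invl (id1 X)).
rassoc. rewrite lun_nat. reflexivity.
Qed.

Lemma lun_inv_comp1 (X Y Z : K) (G : homcat Y Z) (F : homcat X Y) :
  asc_inv (id1 Z) G F ∘ (lun_inv G ▷ F) = lun_inv (G ⊙ F).
Proof.
assert (I : (lun G ▷ F) ∘ (lun_inv G ▷ F) = idm _).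
{ rewrite <- whisker_r_comp, lun_invr, comp2_id. reflexivity. }
rewrite <- (comp_idl (_ ∘ _)), <- (lun_invl (G ⊙ F)), <- lun_comp1. rassoc.
rw asc_invr. rewrite comp_idl, I, comp_idr. reflexivity.
Qed.

(** * The laws of monad maps in strict form *)

Section MonadMaps.
Variables (X Y : K) (P : homcat X X) (Q : homcat Y Y).

Definition mu_law (mP : hom (P ⊙ P) P) (mQ : hom (Q ⊙ Q) Q) (F : homcat X Y)
  (c : hom (Q ⊙ F) (F ⊙ P)) : Prop :=
  c ∘ (mQ ▷ F)
  = (F ◁ mP) ∘ asc_inv F P P ∘ (c ▷ P) ∘ asc Q F P ∘ (Q ◁ c) ∘ asc_inv Q Q F.

Definition eta_law (eP : hom (id1 X) P) (eQ : hom (id1 Y) Q) (F : homcat X Y)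
  (c : hom (Q ⊙ F) (F ⊙ P)) : Prop :=
  c ∘ (eQ ▷ F) = (F ◁ eP) ∘ run_inv F ∘ lun F.

End MonadMaps.

(** A 1-cell [G] acts on all hom-categories into its source by [F |-> G ⊙ F], and
    a cell [Q ⊙ G -> G ⊙ P] acts by natural maps between the iterated actions.
    Composition of such actions is strictly associative.  Bracketing everything
    to the right, with a variable 1-cell [F] at the end, therefore turns the laws
    of monad maps into equations without coherence cells. *)
Definition act_cell (X Y Z : K) (P : homcat X X) (Q : homcat Y Y)
  (G : homcat X Y) (c : hom (Q ⊙ G) (G ⊙ P)) (F : homcat Z X) :
  hom (Q ⊙ G ⊙ F) (G ⊙ P ⊙ F) :=
  asc_inv G P F ∘ (c ▷ F) ∘ asc Q G F.

Definition act_mu (X Z : K) (P : homcat X X) (m : hom (P ⊙ P) P)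
  (F : homcat Z X) : hom (P ⊙ P ⊙ F) (P ⊙ F) := (m ▷ F) ∘ asc P P F.

Definition act_eta (X Z : K) (P : homcat X X) (e : hom (id1 X) P)
  (F : homcat Z X) : hom F (P ⊙ F) := (e ▷ F) ∘ lun_inv F.

Lemma act_cell_nat (X Y Z : K) (P : homcat X X) (Q : homcat Y Y)
  (G : homcat X Y) (c : hom (Q ⊙ G) (G ⊙ P)) (F F' : homcat Z X)
  (a : hom F F') :
  act_cell c F' ∘ (Q ◁ G ◁ a) = (G ◁ P ◁ a) ∘ act_cell c F.
Proof.
unfold act_cell. rassoc. rewrite asc_nat_r. rw whisker_exchange.
rw asc_inv_nat_r. reflexivity.
Qed.

Lemma act_mu_nat (X Z : K) (P : homcat X X) (m : hom (P ⊙ P) P)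
  (F F' : homcat Z X) (a : hom F F') :
  act_mu m F' ∘ (P ◁ P ◁ a) = (P ◁ a) ∘ act_mu m F.
Proof.
unfold act_mu. rassoc. rewrite asc_nat_r. rw whisker_exchange. reflexivity.
Qed.

Lemma act_eta_nat (X Z : K) (P : homcat X X) (e : hom (id1 X) P)
  (F F' : homcat Z X) (a : hom F F') :
  act_eta e F' ∘ a = (P ◁ a) ∘ act_eta e F.
Proof.
unfold act_eta. rassoc. rewrite lun_inv_nat. rw whisker_exchange. reflexivity.
Qed.

Lemma pentagon_inv_m (X Y Z W V : K) (L : homcat W V) (H : homcat Z W)
  (G : homcat Y Z) (F : homcat X Y) :
  asc_inv L (H ⊙ G) F ∘ (asc_inv L H G ▷ F)
  = (L ◁ asc H G F) ∘ asc_inv L H (G ⊙ F) ∘ asc_inv (L ⊙ H) G F.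
Proof.
assert (I : (asc_inv L H G ▷ F) ∘ (asc L H G ▷ F) = idm _).
{ rewrite <- whisker_r_comp, asc_invl, comp2_id. reflexivity. }
apply asc_inj_r, asc_inj_r. rassoc.
rw (asc_invl (L ⊙ H)). rewrite comp_idl, asc_invl, comp_idr, pentagon.
rassoc. rw I. rewrite comp_idl. rw asc_invl. apply comp_idl.
Qed.

Lemma pentagon_m (X Y Z W V : K) (L : homcat W V) (H : homcat Z W)
  (G : homcat Y Z) (F : homcat X Y) :
  asc_inv (L ⊙ H) G F ∘ (asc L H G ▷ F)
  = asc L H (G ⊙ F) ∘ (L ◁ asc_inv H G F) ∘ asc_inv L (H ⊙ G) F.
Proof.
assert (I : (L ◁ asc H G F) ∘ (L ◁ asc_inv H G F) = idm _).
{ rewrite <- whisker_l_comp, asc_invr, comp2_id. reflexivity. }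
apply asc_inj_l, asc_inj_r. rassoc.
rewrite asc_invl, comp_idr. rw pentagon. rw I. rewrite comp_idr.
rw asc_invr. rewrite comp_idl. reflexivity.
Qed.

Section Act.
Variables (X Y : K) (P : homcat X X) (Q : homcat Y Y) (G : homcat X Y)
  (c : hom (Q ⊙ G) (G ⊙ P)).

(** The pentagons that arise when [mu_law] is whiskered with [F] turn its
    associators into those inside the actions.  Conversely, the strict form at
    [F = id1 X] gives the law back, because whiskering with an identity is
    faithful. *)
Lemma mu_law_act (mP : hom (P ⊙ P) P) (mQ : hom (Q ⊙ Q) Q) :
  mu_law mP mQ c <->
  forall (Z : K) (F : homcat Z X),
    act_cell c F ∘ act_mu mQ (G ⊙ F)
    = (G ◁ act_mu mP F) ∘ act_cell c (P ⊙ F) ∘ (Q ◁ act_cell c F).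
Proof.
assert (L : forall (Z : K) (F : homcat Z X),
  act_cell c F ∘ act_mu mQ (G ⊙ F)
  = asc_inv G P F ∘ ((c ∘ (mQ ▷ G)) ▷ F) ∘ asc (Q ⊙ Q) G F ∘ asc Q Q (G ⊙ F)).
{ intros Z F. unfold act_cell, act_mu. rewrite whisker_r_comp. rassoc.
  rw asc_nat_l. reflexivity. }
assert (R : forall (Z : K) (F : homcat Z X),
  (G ◁ act_mu mP F) ∘ act_cell c (P ⊙ F) ∘ (Q ◁ act_cell c F)
  = asc_inv G P F ∘ ((((G ◁ mP) ∘ asc_inv G P P ∘ (c ▷ P) ∘ asc Q G P ∘ (Q ◁ c)
     ∘ asc_inv Q Q G)) ▷ F) ∘ asc (Q ⊙ Q) G F ∘ asc Q Q (G ⊙ F)).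
{ intros Z F. unfold act_cell, act_mu. rewrite !whisker_r_comp, !whisker_l_comp.
  rassoc. rw asc_inv_nat_m. rw pentagon_inv_m. rw asc_inv_nat_l. rw pentagon_m.
  rw asc_inv_nat_m. rw pentagon_inv_m. rw asc_invl. rewrite comp_idl.
  rewrite asc_invl, comp_idr. reflexivity. }
split.
- intros E Z F. rewrite L, R, E. reflexivity.
- intros E. specialize (E X (id1 X)). rewrite L, R in E.
  apply asc_inj_r, asc_inj_r, (cancel_l (asc_invr _ _ _)), run_inj in E.
  exact E.
Qed.

(** When [Q ⊙ G] is regarded as a [Q0]-algebra along [j], the cell [c] is a
    morphism of algebras into [G ⊙ P], and the action on the target depends on
    [c ∘ (j ▷ G)] only.  For a free monad this is the cell that [c] extends. *)
Lemma mu_law_restrict (Q0 : homcat Y Y) (j : hom Q0 Q) (mP : hom (P ⊙ P) P)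
  (mQ : hom (Q ⊙ Q) Q) :
  mu_law mP mQ c ->
  c ∘ (act_mu mQ G ∘ (j ▷ (Q ⊙ G)))
  = (G ◁ mP) ∘ asc_inv G P P ∘ ((c ∘ (j ▷ G)) ▷ P) ∘ asc Q0 G P ∘ (Q0 ◁ c).
Proof.
intros E. unfold act_mu. rassoc. rw E. rw asc_invl. rewrite comp_idl.
rewrite <- (whisker_exchange j c). rw asc_nat_l. rewrite whisker_r_comp. rassoc.
reflexivity.
Qed.

Lemma eta_law_act (eP : hom (id1 X) P) (eQ : hom (id1 Y) Q) :
  eta_law eP eQ c <->
  forall (Z : K) (F : homcat Z X),
    act_cell c F ∘ act_eta eQ (G ⊙ F) = G ◁ act_eta eP F.
Proof.
assert (L : forall (Z : K) (F : homcat Z X),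
  act_cell c F ∘ act_eta eQ (G ⊙ F)
  = asc_inv G P F ∘ ((c ∘ (eQ ▷ G)) ▷ F) ∘ asc (id1 Y) G F ∘ lun_inv (G ⊙ F)).
{ intros Z F. unfold act_cell, act_eta. rewrite whisker_r_comp. rassoc.
  rw asc_nat_l. reflexivity. }
assert (R : forall (Z : K) (F : homcat Z X),
  G ◁ act_eta eP F
  = asc_inv G P F ∘ (((G ◁ eP) ∘ run_inv G ∘ lun G) ▷ F) ∘ asc (id1 Y) G F
    ∘ lun_inv (G ⊙ F)).
{ intros Z F. unfold act_eta. rewrite !whisker_r_comp, whisker_l_comp.
  rassoc. rw lun_comp1. rewrite lun_invr, comp_idr. rw asc_inv_nat_m.
  f_equal. apply asc_inj_l. rw asc_invr. rewrite comp_idl.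
  apply (@cancel_l _ _ _ _ (run_inv G ▷ F) (run G ▷ F)).
  - rewrite <- whisker_r_comp, run_invl. apply comp2_id.
  - rw triangle. rewrite <- whisker_l_comp, <- whisker_r_comp.
    rewrite lun_invr, run_invr, !comp2_id. reflexivity. }
split.
- intros E Z F. rewrite L, R, E. reflexivity.
- intros E. specialize (E X (id1 X)). rewrite L, R in E.
  apply (cancel_r (lun_invl _)), asc_inj_r in E.
  apply (cancel_l (asc_invr _ _ _)), run_inj in E. exact E.
Qed.
End Act.

(** * Composites and identities of monad maps *)

Definition comp_cell (X Y Z : K) (P : homcat X X) (Q : homcat Y Y)
  (R : homcat Z Z) (H : homcat Y Z) (G : homcat X Y)
  (d : hom (R ⊙ H) (H ⊙ Q)) (c : hom (Q ⊙ G) (G ⊙ P)) :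
  hom (R ⊙ H ⊙ G) ((H ⊙ G) ⊙ P) :=
  asc H G P ∘ (H ◁ c) ∘ asc_inv H Q G ∘ (d ▷ G) ∘ asc R H G.

Section Composite.
Variables (X Y Z : K) (P : homcat X X) (Q : homcat Y Y) (R : homcat Z Z).
Variables (H : homcat Y Z) (G : homcat X Y).
Variables (d : hom (R ⊙ H) (H ⊙ Q)) (c : hom (Q ⊙ G) (G ⊙ P)).

(** Up to [(H ⊙ G) ⊙ F ≅ H ⊙ (G ⊙ F)] the composite acts by the composite of the
    actions, so that the laws of a composite follow by naturality. *)
Lemma act_comp_cell (W : K) (F : homcat W X) :
  act_cell (comp_cell d c) F
  = asc H G (P ⊙ F) ∘ (H ◁ act_cell c F) ∘ act_cell d (G ⊙ F)
    ∘ (R ◁ asc_inv H G F).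
Proof.
assert (I : (R ◁ asc H G F) ∘ (R ◁ asc_inv H G F) = idm _).
{ rewrite <- whisker_l_comp, asc_invr, comp2_id. reflexivity. }
unfold act_cell, comp_cell. rewrite !whisker_r_comp, !whisker_l_comp. rassoc.
rw pentagon_m. rw asc_inv_nat_m. rw pentagon_inv_m. rw asc_inv_nat_l.
rw pentagon_m. rewrite asc_invl, comp_idr. reflexivity.
Qed.

Lemma mu_law_comp (mP : hom (P ⊙ P) P) (mQ : hom (Q ⊙ Q) Q)
  (mR : hom (R ⊙ R) R) :
  mu_law mQ mR d -> mu_law mP mQ c -> mu_law mP mR (comp_cell d c).
Proof.
rewrite !mu_law_act. intros Ed Ec W F. rewrite !act_comp_cell.
assert (I : (R ◁ asc_inv H G (P ⊙ F)) ∘ (R ◁ asc H G (P ⊙ F)) = idm _).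
{ rewrite <- whisker_l_comp, asc_invl, comp2_id. reflexivity. }
rewrite !whisker_l_comp. rassoc. rw I. rewrite comp_idl.
rewrite <- act_mu_nat. rw Ed. rw act_cell_nat.
rewrite (comp_assoc (H ◁ act_cell c F)), <- whisker_l_comp, Ec.
rewrite !whisker_l_comp. rassoc. rw asc_nat_r. reflexivity.
Qed.

Lemma eta_law_comp (eP : hom (id1 X) P) (eQ : hom (id1 Y) Q)
  (eR : hom (id1 Z) R) :
  eta_law eQ eR d -> eta_law eP eQ c -> eta_law eP eR (comp_cell d c).
Proof.
rewrite !eta_law_act. intros Ed Ec W F. rewrite act_comp_cell.
rassoc. rewrite <- act_eta_nat. rw Ed. rewrite (comp_assoc (H ◁ act_cell c F)).
rewrite <- whisker_l_comp, Ec. rw asc_nat_r. rewrite asc_invr, comp_idr.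
reflexivity.
Qed.

(** Pasting of squares: applied to the units of free monads, it says that the
    composite of two extended cells extends the composite cell. *)
Lemma comp_cell_extend (P0 : homcat X X) (Q0 : homcat Y Y) (R0 : homcat Z Z)
  (i : hom P0 P) (j : hom Q0 Q) (k : hom R0 R)
  (d0 : hom (R0 ⊙ H) (H ⊙ Q0)) (c0 : hom (Q0 ⊙ G) (G ⊙ P0)) :
  d ∘ (k ▷ H) = (H ◁ j) ∘ d0 -> c ∘ (j ▷ G) = (G ◁ i) ∘ c0 ->
  comp_cell d c ∘ (k ▷ (H ⊙ G)) = ((H ⊙ G) ◁ i) ∘ comp_cell d0 c0.
Proof.
intros Ed Ec. unfold comp_cell. rassoc. rw asc_nat_l.
rewrite (comp_assoc (d ▷ G)), <- whisker_r_comp, Ed, whisker_r_comp. rassoc.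
rw asc_inv_nat_m. rewrite (comp_assoc (H ◁ c)), <- whisker_l_comp, Ec.
rewrite whisker_l_comp. rassoc. rw asc_nat_r. reflexivity.
Qed.
End Composite.

(** Under [S ⊙ id1 Y ≅ S] and [id1 Y ⊙ R ≅ R], the monad maps with 1-cell [id1 Y]
    are the morphisms of monoids from [S] to [R]. *)
Section IdentityMaps.
Variables (Y : K) (R S : homcat Y Y) (b : hom S R).

Definition id_cell : hom (S ⊙ id1 Y) (id1 Y ⊙ R) := lun_inv R ∘ b ∘ run S.

Lemma id_cell_precomp (Q : homcat Y Y) (i : hom Q S) :
  id_cell ∘ (i ▷ id1 Y) = lun_inv R ∘ (b ∘ i) ∘ run Q.
Proof. unfold id_cell. rassoc. rewrite run_nat. reflexivity. Qed.

Lemma mu_law_id (mR : hom (R ⊙ R) R) (mS : hom (S ⊙ S) S) :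
  mu_law mR mS id_cell <-> b ∘ mS = mR ∘ (b ⋆ b).
Proof.
assert (I : (run S ▷ R) ∘ asc S (id1 Y) R ∘ (S ◁ lun_inv R) = idm _).
{ rewrite triangle, <- whisker_l_comp, lun_invr. apply comp2_id. }
assert (I' : (S ◁ run S) ∘ asc_inv S S (id1 Y) = run (S ⊙ S)).
{ rewrite <- run_comp1. rassoc. rewrite asc_invr. apply comp_idr. }
assert (L : id_cell ∘ (mS ▷ id1 Y) = lun_inv R ∘ (b ∘ mS) ∘ run (S ⊙ S)).
{ unfold id_cell. rassoc. rewrite run_nat. reflexivity. }
assert (R' : (id1 Y ◁ mR) ∘ asc_inv (id1 Y) R R ∘ (id_cell ▷ R)
  ∘ asc S (id1 Y) R ∘ (S ◁ id_cell) ∘ asc_inv S S (id1 Y)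
  = lun_inv R ∘ (mR ∘ (b ⋆ b)) ∘ run (S ⊙ S)).
{ unfold id_cell. rewrite !whisker_r_comp, !whisker_l_comp. rassoc.
  rewrite I'. rewrite <- comp_assoc in I.
  rewrite (comp_assoc (asc S (id1 Y) R)), (comp_assoc (run S ▷ R)), I, comp_idl.
  rw lun_inv_comp1. rw <- lun_inv_nat. rewrite (whisker_rl b b). rassoc.
  reflexivity. }
unfold mu_law. rewrite L, R'. split; [|intros ->; reflexivity].
intros E. apply (cancel_r (run_invr _)), (cancel_l (lun_invr _)) in E. exact E.
Qed.

Lemma eta_law_id (eR : hom (id1 Y) R) (eS : hom (id1 Y) S) :
  eta_law eR eS id_cell <-> b ∘ eS = eR.
Proof.
assert (L : id_cell ∘ (eS ▷ id1 Y) = lun_inv R ∘ (b ∘ eS) ∘ run (id1 Y)).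
{ unfold id_cell. rassoc. rewrite run_nat. reflexivity. }
assert (R' : (id1 Y ◁ eR) ∘ run_inv (id1 Y) ∘ lun (id1 Y)
  = lun_inv R ∘ eR ∘ run (id1 Y)).
{ rewrite lun_id1, <- comp_assoc, run_invl, comp_idr, lun_inv_nat. rassoc.
  rewrite <- lun_id1, lun_invl. symmetry; apply comp_idr. }
unfold eta_law. rewrite L, R'. split; [|intros ->; reflexivity].
intros E. apply (cancel_r (run_invr _)), (cancel_l (lun_invr _)) in E. exact E.
Qed.
End IdentityMaps.

Lemma id_cell_idm (Y : K) (R : homcat Y Y) : id_cell (idm R) = lun_inv R ∘ run R.
Proof. unfold id_cell. rewrite comp_idr. reflexivity. Qed.

Lemma identity_laws (Y : K) (R : homcat Y Y) (n : MonadStr (MkEndo R)) :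
  mu_law (mu n) (mu n) (lun_inv R ∘ run R) /\
  eta_law (eta n) (eta n) (lun_inv R ∘ run R).
Proof.
rewrite <- id_cell_idm, mu_law_id, eta_law_id, comp2_id, !comp_idl, comp_idr.
split; reflexivity.
Qed.

Lemma identity_cell_nat (Y : K) (R S : homcat Y Y) (b : hom S R) :
  (lun_inv R ∘ run R) ∘ (b ▷ id1 Y) = (id1 Y ◁ b) ∘ (lun_inv S ∘ run S).
Proof. rassoc. rewrite run_nat. rw lun_inv_nat. reflexivity. Qed.

Lemma id_cell_inj (Y : K) (R S : homcat Y Y) (a b : hom S R) :
  id_cell a = id_cell b -> a = b.
Proof.
unfold id_cell. intros E.
apply (cancel_r (run_invr _)), (cancel_l (lun_invr _)) in E. exact E.
Qed.

Lemma id_cell_surj (Y : K) (R S : homcat Y Y) (c : hom (S ⊙ id1 Y) (id1 Y ⊙ R)) :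
  id_cell (lun R ∘ c ∘ run_inv S) = c.
Proof.
unfold id_cell. rassoc. rewrite run_invl, comp_idr, comp_assoc, lun_invl.
apply comp_idl.
Qed.

(** * Free monads in a bicategory *)

Lemma lun_whisker_id1 (X : K) : id1 X ◁ lun (id1 X) = lun (id1 X ⊙ id1 X).
Proof. apply (cancel_l (lun_invl (id1 X))). apply lun_nat. Qed.

Definition identity_monad (X : K) : Monad K.
Proof.
refine (@MkMonad K (MkEndo (id1 X))
  (@Build_MonadStr K (MkEndo (id1 X)) (lun (id1 X)) (idm (id1 X)) _ _ _)); simpl.
- rewrite lun_whisker_id1, <- comp_assoc, lun_comp1. reflexivity.
- rewrite comp2_id. apply comp_idr.
- rewrite comp2_id, comp_idr. apply lun_id1.
Defined.

Section Free.
Variables (Y : K) (Q S : homcat Y Y) (m : MonadStr (MkEndo S)) (i : hom Q S).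
Hypothesis free : is_free_monad m i.

Definition monad_map_laws (M N : Monad K)
  (F : homcat (carrier M) (carrier N)) (c : hom (endo N ⊙ F) (F ⊙ endo M)) :=
  mu_law (mu (mstr M)) (mu (mstr N)) c /\ eta_law (eta (mstr M)) (eta (mstr N)) c.

Definition mk_monad_map (M N : Monad K)
  (F : homcat (carrier M) (carrier N)) (c : hom (endo N ⊙ F) (F ⊙ endo M))
  (H : monad_map_laws c) : MonadMap M N :=
  @MkMonadMap K M N (@MkEndMap K M N F c) (proj1 H) (proj2 H).

Let SM : Monad K := MkMonad m.

(** The object part of the isomorphism of categories that defines freeness.  The
    1-cell of the lifted map equals [F] only up to a propositional equality;
    eliminating the equality of endomorphism maps makes it [F] itself. *)
Lemma free_monad_lift (M : Monad K) (F : homcat (carrier M) Y)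
  (p : hom (Q ⊙ F) (F ⊙ endo M)) :
  exists c : hom (S ⊙ F) (F ⊙ endo M),
    @monad_map_laws M SM F c /\ c ∘ (i ▷ F) = p.
Proof.
assert (L : forall B : EndMap M (MkEndo Q),
  exists c : hom (S ⊙ emap B) (emap B ⊙ endo M),
    @monad_map_laws M SM (emap B) c /\ c ∘ (i ▷ emap B) = ecell B).
{ intros B. destruct (proj1 (free M) B) as [[[F' c] H1 H2] [E _]].
  simpl in E. rewrite <- E. exists c. split; [split; assumption | reflexivity]. }
exact (L (@MkEndMap K M (MkEndo Q) F p)).
Qed.

Lemma free_monad_cell (M : Monad K) (F F' : homcat (carrier M) Y)
  (c : hom (S ⊙ F) (F ⊙ endo M)) (c' : hom (S ⊙ F') (F' ⊙ endo M))
  (a : hom F F') :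
  @monad_map_laws M SM F c -> @monad_map_laws M SM F' c' ->
  (a ▷ endo M) ∘ (c ∘ (i ▷ F)) = (c' ∘ (i ▷ F')) ∘ (Q ◁ a) ->
  (a ▷ endo M) ∘ c = c' ∘ (S ◁ a).
Proof.
intros H H' E.
pose (f := mk_monad_map H). pose (f' := mk_monad_map H').
destruct (proj2 (free M) f f' (@MkEndCell K M (MkEndo Q) (postcomp_map i f)
   (postcomp_map i f') a E)) as [b [Eb _]].
apply (f_equal (fun x => ec x)) in Eb. simpl in Eb.
pose proof (ec_eq b) as D. simpl in D. rewrite Eb in D. exact D.
Qed.

(** Fullness at an identity cell already separates the extensions of a cell, so
    no equality between dependent records has to be inverted. *)
Lemma free_monad_unique (M : Monad K) (F : homcat (carrier M) Y)
  (c c' : hom (S ⊙ F) (F ⊙ endo M)) :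
  @monad_map_laws M SM F c -> @monad_map_laws M SM F c' ->
  c ∘ (i ▷ F) = c' ∘ (i ▷ F) -> c = c'.
Proof.
intros H H' E. pose proof (@free_monad_cell M F F c c' (idm F) H H') as D.
rewrite !comp2_id, !comp_idl, !comp_idr in D. exact (D E).
Qed.

Lemma free_monad_monoid (R : homcat Y Y) (mR : MonadStr (MkEndo R))
  (a : hom Q R) :
  exists! b : hom S R,
    b ∘ mu m = mu mR ∘ (b ⋆ b) /\ b ∘ eta m = eta mR /\ b ∘ i = a.
Proof.
assert (L : forall b : hom S R,
  @monad_map_laws (MkMonad mR) SM (id1 Y) (id_cell b) <->
  b ∘ mu m = mu mR ∘ (b ⋆ b) /\ b ∘ eta m = eta mR).
{ intros b. unfold monad_map_laws. simpl. rewrite mu_law_id, eta_law_id.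
  reflexivity. }
destruct (@free_monad_lift (MkMonad mR) (id1 Y) (id_cell a)) as [c [Lc Ec]].
simpl in c, Lc, Ec. rewrite <- (id_cell_surj c) in Lc, Ec.
revert Lc Ec. generalize (lun R ∘ c ∘ run_inv S). intros b Lb Eb.
assert (Ei : b ∘ i = a).
{ apply id_cell_inj. rewrite <- Eb, id_cell_precomp. reflexivity. }
exists b. split.
- apply L in Lb as [H1 H2]. repeat split; assumption.
- intros b' [H1 [H2 H3]]. apply id_cell_inj.
  apply (@free_monad_unique (MkMonad mR) (id1 Y)); [exact Lb | |].
  + apply L. split; assumption.
  + simpl. rewrite !id_cell_precomp, Ei, H3. reflexivity.
Qed.

(** The monad maps out of the identity monad on [X] are the algebras of [S] on
    1-cells [X -> Y].  So freeness against the identity monads says that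
    [S]-algebras and [Q]-algebras are the same, and that [S ⊙ F], the free
    [S]-algebra on [F], is the free [Q]-algebra as well. *)
Section Algebra.
Variables (X : K).

Definition algebra_laws (G : homcat X Y) (h : hom (S ⊙ G) G) : Prop :=
  h ∘ act_mu (mu m) G = h ∘ (S ◁ h) /\ h ∘ act_eta (eta m) G = idm G.

Lemma algebra_monad_map (G : homcat X Y) (h : hom (S ⊙ G) G) :
  algebra_laws h <->
  @monad_map_laws (identity_monad X) SM G (run_inv G ∘ h).
Proof.
assert (Em : (G ◁ lun (id1 X)) ∘ asc_inv G (id1 X) (id1 X)
  ∘ ((run_inv G ∘ h) ▷ id1 X) ∘ asc S G (id1 X) ∘ (S ◁ (run_inv G ∘ h))
  ∘ asc_inv S S G
  = run_inv G ∘ (h ∘ (S ◁ h) ∘ asc_inv S S G)).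
{ rewrite <- triangle, whisker_r_comp, whisker_l_comp. rassoc.
  rw asc_invr. rewrite comp_idl.
  assert (I : (run G ▷ id1 X) ∘ (run_inv G ▷ id1 X) = idm _).
  { rewrite <- whisker_r_comp, run_invr. apply comp2_id. }
  rw I. rewrite comp_idl.
  assert (J : asc S G (id1 X) ∘ (S ◁ run_inv G) = run_inv (S ⊙ G)).
  { apply (cancel_l (run_invl _)). rw run_comp1.
    rewrite <- whisker_l_comp, !run_invr. apply comp2_id. }
  rw J. rw <- run_inv_nat. reflexivity. }
assert (Ee : (G ◁ idm (id1 X)) ∘ run_inv G ∘ lun G = run_inv G ∘ lun G).
{ rewrite comp2_id, comp_idl. reflexivity. }
unfold monad_map_laws, mu_law, eta_law, algebra_laws. simpl.
rewrite Em, Ee. unfold act_mu, act_eta. split; intros [E1 E2]; split.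
- rassoc. f_equal. apply asc_inj_r. rassoc. rewrite asc_invl, comp_idr. exact E1.
- rassoc. f_equal. apply (cancel_r (lun_invl G)). rassoc. rewrite lun_invr.
  exact E2.
- rewrite <- comp_assoc in E1. apply (cancel_l (run_invr G)) in E1.
  rewrite comp_assoc, E1. rassoc. rewrite asc_invl, comp_idr. reflexivity.
- rewrite <- comp_assoc in E2. apply (cancel_l (run_invr G)) in E2.
  rewrite comp_assoc, E2. apply lun_invr.
Qed.

Definition free_action (F : homcat X Y) : hom (Q ⊙ S ⊙ F) (S ⊙ F) :=
  act_mu (mu m) F ∘ (i ▷ (S ⊙ F)).

Lemma act_mu_algebra (F : homcat X Y) : algebra_laws (act_mu (mu m) F).
Proof.
pose proof (mu_assoc m) as A. pose proof (mu_unitl m) as U. simpl in A, U.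
split; unfold act_mu, act_eta; rassoc.
- simpl. rewrite whisker_l_comp. rassoc. rw asc_nat_l.
  rw asc_nat_m.
  apply (f_equal (fun a => a ▷ F)) in A. rewrite !whisker_r_comp in A.
  rw <- A. rewrite (comp_assoc (asc S S S ▷ F)), <- pentagon. reflexivity.
- simpl. rw asc_nat_l. apply (f_equal (fun a => a ▷ F)) in U.
  rewrite whisker_r_comp in U. rw U. rw lun_comp1. apply lun_invr.
Qed.

Lemma act_mu_unit (F : homcat X Y) :
  act_mu (mu m) F ∘ (S ◁ act_eta (eta m) F) = idm (S ⊙ F).
Proof.
pose proof (mu_unitr m) as U. simpl in U. unfold act_mu, act_eta.
rewrite whisker_l_comp. rassoc. rw asc_nat_m.
apply (f_equal (fun a => a ▷ F)) in U. rewrite whisker_r_comp in U. rw U.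
rw triangle.
rewrite <- whisker_l_comp, lun_invr. apply comp2_id.
Qed.

Lemma algebra_extension (E : homcat X Y) (x : hom (Q ⊙ E) E) :
  exists h : hom (S ⊙ E) E, algebra_laws h /\ h ∘ (i ▷ E) = x.
Proof.
destruct (@free_monad_lift (identity_monad X) E (run_inv E ∘ x)) as [c [L D]].
simpl in c, L, D. exists (run E ∘ c). split.
- apply algebra_monad_map. rewrite comp_assoc, run_invl, comp_idl. exact L.
- rewrite <- comp_assoc, D, comp_assoc, run_invr. apply comp_idl.
Qed.

Lemma algebra_morphism (E E' : homcat X Y) (h : hom (S ⊙ E) E)
  (h' : hom (S ⊙ E') E') (a : hom E E') :
  algebra_laws h -> algebra_laws h' ->
  a ∘ (h ∘ (i ▷ E)) = (h' ∘ (i ▷ E')) ∘ (Q ◁ a) -> a ∘ h = h' ∘ (S ◁ a).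
Proof.
intros H H' D. apply algebra_monad_map in H, H'.
pose proof (@free_monad_cell (identity_monad X) E E' _ _ a H H') as C.
simpl in C. revert C. rassoc. rw <- run_inv_nat. rw <- run_inv_nat. intros C.
apply (cancel_l (run_invr E')). apply C. f_equal.
rewrite <- comp_assoc in D. exact D.
Qed.

(** The free [Q]-algebra has no proper subalgebra that contains the unit; here a
    [Q]-algebra is any cell [Q ⊙ E -> E].  The section is the extension of [f] to
    a morphism from the free algebra. *)
Lemma free_algebra_induction (F E : homcat X Y) (x : hom (Q ⊙ E) E)
  (e : hom E (S ⊙ F)) (f : hom F E) :
  e ∘ f = act_eta (eta m) F -> e ∘ x = free_action F ∘ (Q ◁ e) ->
  exists r : hom (S ⊙ F) E, e ∘ r = idm (S ⊙ F).
Proof.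
intros Ef Ex. destruct (algebra_extension x) as [h [Lh Eh]].
exists (h ∘ (S ◁ f)).
rewrite <- Eh in Ex.
pose proof (@algebra_morphism E (S ⊙ F) h (act_mu (mu m) F) e Lh
  (act_mu_algebra F) Ex) as D.
rw D. rewrite <- whisker_l_comp, Ef. apply act_mu_unit.
Qed.

End Algebra.
End Free.
End Bicategory.

(** * Calculus of squares *)

(** Proves that sides of squares match, so that [b ** a] can be written for a
    horizontal composite without naming that proof. *)
Ltac bd :=
  unfold cell_sq; repeat first
   [ rewrite bd0_comp | rewrite bd1_comp | rewrite bd0_hsq | rewrite bd1_hsq
   | rewrite bd0_id | rewrite bd1_id | rewrite bd0_hidsq | rewrite bd1_hidsq
   | rewrite gsq0 | rewrite gsq1 | rewrite bd0_hasc | rewrite bd1_hasc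
   | rewrite bd0_hlun | rewrite bd1_hlun | rewrite bd0_hrun | rewrite bd1_hrun
   | rewrite comp_idl | rewrite comp_idr | progress cbn ]; try congruence.

Notation "b '**' a" := (hsq b a ltac:(bd))
  (at level 38, right associativity, only parsing).

Section Squares.
Variable C : DoubleCat.

Lemma precomp_sq_eq (X Y X1 Y1 X2 Y2 X3 Y3 : C) (F : hor X Y) (F1 : hor X1 Y1)
  (F2 : hor X2 Y2) (F3 : hor X3 Y3) (f : sq F1 F) (g : sq F2 F1) (h : sq F2 F)
  (k : sq F3 F2) : f ∘s g = h -> f ∘s (g ∘s k) = h ∘s k.
Proof. intros <-. apply sqcomp_assoc. Qed.

Lemma precomp_sq_eq3 (X Y X0 Y0 X1 Y1 X2 Y2 X3 Y3 : C) (F : hor X Y)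
  (F0 : hor X0 Y0) (F1 : hor X1 Y1) (F2 : hor X2 Y2) (F3 : hor X3 Y3)
  (f : sq F1 F) (g : sq F2 F1) (g' : sq F0 F2) (h : sq F0 F) (k : sq F3 F0) :
  f ∘s (g ∘s g') = h -> f ∘s (g ∘s (g' ∘s k)) = h ∘s k.
Proof. intros <-. rewrite !sqcomp_assoc. reflexivity. Qed.

Lemma sqcomp_congr (X Y X1 Y1 X2 Y2 : C) (F : hor X Y) (F1 : hor X1 Y1)
  (F2 : hor X2 Y2) (b b' : sq F1 F) (a a' : sq F2 F1) :
  b = b' -> a = a' -> b ∘s a = b' ∘s a'.
Proof. intros <- <-. reflexivity. Qed.

Lemma hsq_sq_eq (X Y Z X1 Y1 Z1 X2 Y2 Z2 X3 Y3 Z3 : C)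
  (G : hor Y Z) (G1 : hor Y1 Z1) (G2 : hor Y2 Z2) (G3 : hor Y3 Z3)
  (F : hor X Y) (F1 : hor X1 Y1) (F2 : hor X2 Y2) (F3 : hor X3 Y3)
  (b1 : sq G G1) (b2 : sq G1 G3) (b3 : sq G G2) (b4 : sq G2 G3)
  (a1 : sq F F1) (a2 : sq F1 F3) (a3 : sq F F2) (a4 : sq F2 F3) e1 e2 e3 e4 :
  b2 ∘s b1 = b4 ∘s b3 -> a2 ∘s a1 = a4 ∘s a3 ->
  hsq b2 a2 e2 ∘s hsq b1 a1 e1 = hsq b4 a4 e4 ∘s hsq b3 a3 e3.
Proof.
intros Eb Ea.
assert (e : bd1 (a2 ∘s a1) = bd0 (b2 ∘s b1)).
{ rewrite bd0_comp, bd1_comp. congruence. }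
assert (e' : bd1 (a4 ∘s a3) = bd0 (b4 ∘s b3)).
{ rewrite bd0_comp, bd1_comp. congruence. }
rewrite <- (interchange e1 e2 e), <- (interchange e3 e4 e').
apply hsq_congr; assumption.
Qed.

Lemma hsq_merge (X Y Z X1 Y1 Z1 X3 Y3 Z3 : C)
  (G : hor Y Z) (G1 : hor Y1 Z1) (G3 : hor Y3 Z3)
  (F : hor X Y) (F1 : hor X1 Y1) (F3 : hor X3 Y3)
  (b1 : sq G G1) (b2 : sq G1 G3) (b : sq G G3)
  (a1 : sq F F1) (a2 : sq F1 F3) (a : sq F F3) e1 e2 e :
  b2 ∘s b1 = b -> a2 ∘s a1 = a ->
  hsq b2 a2 e2 ∘s hsq b1 a1 e1 = hsq b a e.
Proof. intros <- <-. symmetry. apply interchange. Qed.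

Lemma hasc_inv_nat (X Y Z W X' Y' Z' W' : C)
  (H : hor Z W) (H' : hor Z' W') (G : hor Y Z) (G' : hor Y' Z')
  (F : hor X Y) (F' : hor X' Y') (c : sq H H') (b : sq G G') (a : sq F F')
  e1 e2 e3 e4 :
  hasc_inv H' G' F' ∘s hsq (hsq c b e1) a e2
  = hsq c (hsq b a e3) e4 ∘s hasc_inv H G F.
Proof.
rewrite <- (sqcomp_idr (_ ∘s hsq (hsq c b e1) a e2)), <- (hasc_invr H G F).
rewrite !sqcomp_assoc, <- (sqcomp_assoc (hasc_inv H' G' F')).
rewrite <- (hasc_nat e4 e2), sqcomp_assoc, hasc_invl, sqcomp_idl.
reflexivity.
Qed.

(** The naturality laws of the associators, oriented for rewriting: the matching
    proofs on the right are computed from those on the left. *)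
Lemma hasc_nat_from (X Y Z W X' Y' Z' W' : C)
  (H : hor Z W) (H' : hor Z' W') (G : hor Y Z) (G' : hor Y' Z')
  (F : hor X Y) (F' : hor X' Y') (c : sq H H') (b : sq G G') (a : sq F F')
  e1 e2 :
  hsq (hsq c b e1) a e2 ∘s hasc H G F
  = hasc H' G' F' ∘s hsq c (hsq b a (eq_trans e2 (bd0_hsq e1)))
      (eq_trans (bd1_hsq _) e1).
Proof. symmetry. apply hasc_nat. Qed.

Lemma hasc_inv_nat_to (X Y Z W X' Y' Z' W' : C)
  (H : hor Z W) (H' : hor Z' W') (G : hor Y Z) (G' : hor Y' Z')
  (F : hor X Y) (F' : hor X' Y') (c : sq H H') (b : sq G G') (a : sq F F')
  e1 e2 :
  hsq c (hsq b a e1) e2 ∘s hasc_inv H G F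
  = hasc_inv H' G' F'
    ∘s hsq (hsq c b (eq_trans (eq_sym (bd1_hsq e1)) e2)) a
      (eq_trans e1 (eq_sym (bd0_hsq _))).
Proof. symmetry. apply hasc_inv_nat. Qed.

Lemma hlun_inv_nat (X Y X' Y' : C) (F : hor X Y) (F' : hor X' Y')
  (a : sq F F') (v : hom Y Y') e :
  hlun_inv F' ∘s a = hsq (hidsq v) a e ∘s hlun_inv F.
Proof.
assert (E : bd1 a = v) by (rewrite e; apply bd0_hidsq). subst v.
rewrite <- (sqcomp_idr (_ ∘s a)), <- (hlun_invr F), !sqcomp_assoc.
rewrite <- (sqcomp_assoc (hlun_inv F') a), <- (hlun_nat e).
rewrite sqcomp_assoc, hlun_invl, sqcomp_idl. reflexivity.
Qed.

Lemma hrun_inv_nat (X Y X' Y' : C) (F : hor X Y) (F' : hor X' Y')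
  (a : sq F F') (u : hom X X') e :
  hrun_inv F' ∘s a = hsq a (hidsq u) e ∘s hrun_inv F.
Proof.
assert (E : bd0 a = u) by (rewrite <- e; apply bd1_hidsq). subst u.
rewrite <- (sqcomp_idr (_ ∘s a)), <- (hrun_invr F), !sqcomp_assoc.
rewrite <- (sqcomp_assoc (hrun_inv F') a), <- (hrun_nat e).
rewrite sqcomp_assoc, hrun_invl, sqcomp_idl. reflexivity.
Qed.

End Squares.

Ltac sassoc := repeat rewrite <- sqcomp_assoc.

Ltac srw_post n H :=
  first
    [ rewrite (precomp_sq_eq _ H) | rewrite (precomp_sq_eq3 _ H)
    | lazymatch n with S ?m => let H' := uconstr:(H _) in srw_post m H' end ].

Tactic Notation "srw" uconstr(H) :=
  first [ srw_post 24 H | rewrite H ]; repeat rewrite <- sqcomp_assoc.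

(** Identifies composites that differ only in their proofs of matching. *)
Ltac scong :=
  sassoc; repeat first [ reflexivity | apply hsq_congr | apply sqcomp_congr ].

(** * Restriction along vertical arrows *)

Section Lifts.
Variable C : DoubleCat.
Local Notation HC := (horizontal_bicat C).
Hypothesis framed : is_framed_bicategory C.

(** The fibration hypothesis with its equations between objects eliminated: the
    restriction has the prescribed source and target on the nose. *)
Lemma restriction_exists (X Y X' Y' : C) (F : hor X' Y') (u : hom X X')
  (v : hom Y Y') :
  exists (R : hor X Y) (r : sq R F), bd0 r = u /\ bd1 r = v /\
    forall (X0 Y0 : C) (G : hor X0 Y0) (h : sq G F) (k0 : hom X0 X)
      (k1 : hom Y0 Y), u ∘ k0 = bd0 h -> v ∘ k1 = bd1 h ->
      exists! l : sq G R, bd0 l = k0 /\ bd1 l = k1 /\ r ∘s l = h.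
Proof.
(* Only with a variable pair [b] can the equation on the source be eliminated. *)
assert (L : forall (b : prod_cat C C)
    (f : hom b (hsrc (MkHArrow F), htgt (MkHArrow F))),
  exists (R : hor (fst b) (snd b)) (r : sq R F), bd0 r = fst f /\ bd1 r = snd f /\
    forall (X0 Y0 : C) (G : hor X0 Y0) (h : sq G F) (k0 : hom X0 (fst b))
      (k1 : hom Y0 (snd b)), fst f ∘ k0 = bd0 h -> snd f ∘ k1 = bd1 h ->
      exists! l : sq G R, bd0 l = k0 /\ bd1 l = k1 /\ r ∘s l = h).
{ intros b f. destruct (@framed (MkHArrow F) b f) as [[x y R] [r [e [E c]]]].
  simpl in r. destruct e. simpl in *. subst f. exists R, r. simpl.
  split; [reflexivity|]. split; [reflexivity|].
  intros X0 Y0 G h k0 k1 E0 E1.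
  destruct (c (MkHArrow G) h (k0, k1)) as [l [[L1 L2] U]].
  { simpl. rewrite E0, E1. reflexivity. }
  simpl in l, L1, L2, U. exists l. split.
  - split; [exact (f_equal fst L1)|]. split; [exact (f_equal snd L1)|exact L2].
  - intros l' [H1 [H2 H3]]. apply U. split; [|exact H3].
    rewrite H1, H2. reflexivity. }
exact (L (X, Y) (u, v)).
Qed.

Lemma restriction_globular (X Y X' Y' : HC) (F : homcat X' Y')
  (u : @hom C X X') (v : @hom C Y Y') :
  exists (R : homcat X Y) (r : sq R F), bd0 r = u /\ bd1 r = v /\
    (forall (G : homcat X Y) (h : sq G F), bd0 h = u -> bd1 h = v ->
      exists l : hom G R, r ∘s cell_sq l = h) /\
    (forall (G : homcat X Y) (a b : hom G R),
      r ∘s cell_sq a = r ∘s cell_sq b -> a = b).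
Proof.
destruct (restriction_exists F u v) as [R [r [Eu [Ev U]]]].
exists R, r. split; [exact Eu|]. split; [exact Ev|]. split.
- intros G h E0 E1.
  destruct (U X Y G h (idm _) (idm _)) as [l [[L0 [L1 L2]] _]].
  + rewrite comp_idr. symmetry; exact E0.
  + rewrite comp_idr. symmetry; exact E1.
  + exists (MkGlobular L0 L1). exact L2.
- intros G a b E.
  destruct (U X Y G (r ∘s cell_sq a) (idm _) (idm _)) as [l [_ W]];
    [bd.. |].
  apply Globular_eq. transitivity l.
  + symmetry. apply W. split; [apply gsq0|]. split; [apply gsq1|reflexivity].
  + apply W. split; [apply gsq0|]. split; [apply gsq1|]. symmetry; exact E.
Qed.

Hypothesis equalizers : has_equalizers (C1 C).
Hypothesis source_preserves : preserves_equalizers (d0 C).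
Hypothesis target_preserves : preserves_equalizers (d1 C).

(** Equal sides make the sides of the equalizer [E'] of [a] and [b] invertible:
    they are equalizers of equal arrows.  Restricting [E'] along the inverses
    [k0] and [k1] gives a globular cell. *)
Lemma globular_weak_equalizer (X Y X' Y' : HC) (G : homcat X Y)
  (H : homcat X' Y') (a b : sq G H) :
  bd0 a = bd0 b -> bd1 a = bd1 b ->
  exists (E : homcat X Y) (e : hom E G),
    a ∘s cell_sq e = b ∘s cell_sq e /\
    forall (D : homcat X Y) (h : hom D G),
      a ∘s cell_sq h = b ∘s cell_sq h -> exists k : hom D E, e ∘ k = h.
Proof.
intros E0 E1.
destruct (@equalizers (MkHArrow G) (MkHArrow H) a b) as [[x y E'] [e' Q]].
simpl in e'.
pose proof (source_preserves Q) as Q0. pose proof (target_preserves Q) as Q1.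
simpl in Q0, Q1.
destruct (proj2 Q0 _ (idm X)) as [k0 [K0 U0]].
{ simpl. rewrite E0. reflexivity. }
destruct (proj2 Q1 _ (idm Y)) as [k1 [K1 U1]].
{ simpl. rewrite E1. reflexivity. }
simpl in *.
destruct (restriction_exists E' k0 k1) as [E [r [R0 [R1 U]]]].
assert (G0 : bd0 (e' ∘s r) = idm X) by (rewrite bd0_comp, R0; exact K0).
assert (G1 : bd1 (e' ∘s r) = idm Y) by (rewrite bd1_comp, R1; exact K1).
exists E, (MkGlobular G0 G1). unfold cell_sq. simpl. split.
- rewrite !sqcomp_assoc. f_equal. exact (proj1 Q).
- intros D h Eh.
  destruct (proj2 Q (MkHArrow D) (gsq h) Eh) as [k [Kh _]]. simpl in k, Kh.
  destruct (U X Y D k (idm _) (idm _)) as [l [[L0 [L1 L2]] _]].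
  + rewrite comp_idr. apply U0. rewrite <- bd0_comp, Kh. apply gsq0.
  + rewrite comp_idr. apply U1. rewrite <- bd1_comp, Kh. apply gsq1.
  + exists (MkGlobular L0 L1). apply Globular_eq. simpl.
    rewrite <- sqcomp_assoc, L2. exact Kh.
Qed.
End Lifts.

(** * Squares out of a free algebra *)

Section FreeSquare.
Variable C : DoubleCat.
Local Notation HC := (horizontal_bicat C).
Variables (X Y X' Y' : HC).
Variables (P S : homcat X X) (Q T : homcat Y Y).
Variables (P' : homcat X' X') (Q' : homcat Y' Y').
Variables (F : homcat X Y) (F' : homcat X' Y').
Variables (mS : hom (S ⊙ S) S) (nS : hom (id1 X) S).
Variables (mT : hom (T ⊙ T) T) (nT : hom (id1 Y) T).
Variables (mP : hom (P' ⊙ P') P') (nP : hom (id1 X') P').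
Variables (mQ : hom (Q' ⊙ Q') Q') (nQ : hom (id1 Y') Q').
Variables (i : hom P S) (j : hom Q T).
Variables (p : hom (Q ⊙ F) (F ⊙ P)) (c : hom (T ⊙ F) (F ⊙ S)).
Variable (p' : hom (Q' ⊙ F') (F' ⊙ P')).
Hypotheses (c_mu : mu_law mS mT c) (c_eta : eta_law nS nT c).
Hypotheses (p_mu : mu_law mP mQ p') (p_eta : eta_law nP nQ p').
Hypothesis c_p : c ∘ (j ▷ F) = (F ◁ i) ∘ p.
Variables (u : @hom C X X') (v : @hom C Y Y').
Variables (us : sq S P') (vs : sq T Q') (al : sq F F').
Hypotheses (us0 : bd0 us = u) (us1 : bd1 us = u).
Hypotheses (vs0 : bd0 vs = v) (vs1 : bd1 vs = v).
Hypotheses (al0 : bd0 al = u) (al1 : bd1 al = v).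
Hypothesis us_mu : forall e, us ∘s cell_sq mS = cell_sq mP ∘s hsq us us e.
Hypothesis us_eta : us ∘s cell_sq nS = cell_sq nP ∘s hidsq u.
Hypothesis vs_mu : forall e, vs ∘s cell_sq mT = cell_sq mQ ∘s hsq vs vs e.
Hypothesis vs_eta : vs ∘s cell_sq nT = cell_sq nQ ∘s hidsq v.
Hypothesis al_eq : forall e e',
  hsq al (us ∘s cell_sq i) e ∘s cell_sq p
  = cell_sq p' ∘s hsq (vs ∘s cell_sq j) al e'.

(* The two sides of the equation that makes [al] a square between the extended
   maps [c] and [p'], and the actions of [Q] on [T ⊙ F] and of [Q'] on [F' ⊙ P'].
   In the application [S] and [T] are the free monads on [P] and [Q]. *)
Let lhs : sq (T ⊙ F) (F' ⊙ P') := (al ** us) ∘s cell_sq c.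
Let rhs : sq (T ⊙ F) (F' ⊙ P') := cell_sq p' ∘s (vs ** al).
Let act : hom (Q ⊙ T ⊙ F) (T ⊙ F) := act_mu mT F ∘ (j ▷ (T ⊙ F)).
Let act' : sq (Q' ⊙ F' ⊙ P') (F' ⊙ P') :=
  cell_sq ((F' ◁ mP) ∘ asc_inv F' P' P' ∘ (p' ▷ P') ∘ asc Q' F' P').

(** Equivariance of the second side: [vs] turns the multiplication of [T] into
    that of [Q'], and [p'] passes it on to [P']. *)
Lemma rhs_action e : rhs ∘s cell_sq act = act' ∘s hsq (vs ∘s cell_sq j) rhs e.
Proof.
assert (E1 : forall e1 e2, hsq vs al e1 ∘s hsq (cell_sq mT) (sqid F) e2
  = (cell_sq mQ ** sqid F') ∘s ((vs ** vs) ** al)).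
{ intros. apply hsq_sq_eq; [apply vs_mu|].
  rewrite sqcomp_idl, sqcomp_idr. reflexivity. }
assert (E3 : forall e0 e1 e2,
  hsq vs (hsq vs al e0) e1 ∘s hsq (cell_sq j) (sqid (hcomp T F)) e2
  = (vs ∘s cell_sq j) ** (vs ** al)).
{ intros. apply hsq_merge; [reflexivity|]. rewrite sqcomp_idr. scong. }
assert (E2 : forall e1,
  cell_sq p' ∘s (hsq (cell_sq mQ) (sqid F') e1 ∘s hasc Q' Q' F')
  = act' ∘s (sqid Q' ** cell_sq p')).
{ intros e1. pose proof (mu_law_restrict (idm Q') p_mu) as E2.
  rewrite !comp2_id, !comp_idr in E2.
  apply (f_equal (fun x => cell_sq x)) in E2.
  etransitivity; [|etransitivity; [exact E2|]];
  unfold act', act_mu, cell_sq; cbn; scong. }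
transitivity (cell_sq p' ∘s (vs ** al) ∘s (cell_sq mT ** sqid F)
  ∘s hasc T T F ∘s (cell_sq j ** sqid (hcomp T F))).
{ unfold rhs, act, act_mu, cell_sq. cbn. scong. }
unfold cell_sq in *; cbn in *. sassoc.
srw E1. srw hasc_nat_from. srw E2. f_equal. unfold rhs. cbn.
rewrite E3. do 3 f_equal. apply hsq_merge; [apply sqcomp_idl | scong].
Qed.

(** Equivariance of the first side: [c] passes the multiplication of [T] on to
    [S], and [us] turns it into that of [P']; the remaining occurrence of [c] is
    restricted to [Q], where the hypothesis on [al] applies. *)
Lemma lhs_action e : lhs ∘s cell_sq act = act' ∘s hsq (vs ∘s cell_sq j) lhs e.
Proof.
assert (E1 : cell_sq c ∘s cell_sq act
  = cell_sq (F ◁ mS) ∘s hasc_inv F S S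
    ∘s (cell_sq ((F ◁ i) ∘ p) ** sqid S) ∘s hasc Q F S ∘s (sqid Q ** cell_sq c)).
{ rewrite <- c_p. pose proof (mu_law_restrict j c_mu) as E1.
  apply (f_equal (fun x => cell_sq x)) in E1.
  etransitivity; [exact E1|]. unfold cell_sq. cbn. scong. }
assert (E2 : forall e1, hsq al us e1 ∘s cell_sq (F ◁ mS)
  = cell_sq (F' ◁ mP) ∘s (al ** (us ** us))).
{ intros e1. unfold cell_sq. cbn. apply hsq_sq_eq; [|apply us_mu].
  rewrite sqcomp_idl, sqcomp_idr. reflexivity. }
assert (E3 : forall e1, hsq al us e1 ∘s cell_sq ((F ◁ i) ∘ p)
  = cell_sq p' ∘s ((vs ∘s cell_sq j) ** al)).
{ intros e1.
  transitivity ((al ** (us ∘s cell_sq i)) ∘s cell_sq p); [|apply al_eq].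
  unfold cell_sq. cbn. rewrite sqcomp_assoc. apply sqcomp_congr; [|reflexivity].
  apply hsq_merge; [apply sqcomp_idr | reflexivity]. }
assert (E4 : forall e1 e2 e3, hsq (hsq al us e1) us e2
    ∘s hsq (cell_sq ((F ◁ i) ∘ p)) (sqid S) e3
  = cell_sq (p' ▷ P') ∘s (((vs ∘s cell_sq j) ** al) ** us)).
{ intros e1 e2 e3. unfold cell_sq at 2. cbn. apply hsq_sq_eq; [apply E3|].
  rewrite sqcomp_idl, sqcomp_idr. reflexivity. }
unfold lhs, act', cell_sq in *. cbn in *.
rewrite <- sqcomp_assoc, E1. sassoc. srw E2. srw hasc_inv_nat_to.
srw E4. srw hasc_nat_from.
do 4 f_equal. apply hsq_merge; [apply sqcomp_idr | scong].
Qed.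

Lemma lhs_rhs_unit :
  lhs ∘s cell_sq (act_eta nT F) = rhs ∘s cell_sq (act_eta nT F).
Proof.
transitivity (cell_sq (F' ◁ nP) ∘s hrun_inv F' ∘s al).
- assert (E : cell_sq c ∘s cell_sq (act_eta nT F)
    = cell_sq (F ◁ nS) ∘s hrun_inv F).
  { assert (E : c ∘ act_eta nT F = (F ◁ nS) ∘ run_inv F).
    { unfold act_eta. rewrite comp_assoc, c_eta. rassoc.
      rewrite lun_invr, comp_idr. reflexivity. }
    exact (f_equal (fun x => cell_sq x) E). }
  unfold lhs, cell_sq in *. cbn in *. rewrite <- sqcomp_assoc, E.
  rewrite <- sqcomp_assoc, (hrun_inv_nat (a := al) (u := u) ltac:(bd)).
  rewrite !sqcomp_assoc. f_equal.
  apply hsq_sq_eq; [|exact us_eta]. rewrite sqcomp_idl, sqcomp_idr. reflexivity.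
- assert (E : cell_sq p' ∘s cell_sq (nQ ▷ F') ∘s hlun_inv F'
    = cell_sq (F' ◁ nP) ∘s hrun_inv F').
  { assert (E : p' ∘ (nQ ▷ F') ∘ lun_inv F' = (F' ◁ nP) ∘ run_inv F').
    { rewrite p_eta. rassoc. rewrite lun_invr, comp_idr. reflexivity. }
    exact (f_equal (fun x => cell_sq x) E). }
  rewrite <- E. unfold rhs, act_eta, cell_sq in *. cbn in *. sassoc.
  rewrite (hlun_inv_nat (a := al) (v := v) ltac:(bd)).
  f_equal. rewrite !sqcomp_assoc. f_equal.
  apply hsq_sq_eq; [symmetry; exact vs_eta|].
  rewrite sqcomp_idl, sqcomp_idr. reflexivity.
Qed.

(** The hypothesis [ind] is the induction principle of the free algebra [T ⊙ F].
    It is applied to the equalizer of the two sides. *)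
Lemma endomorphism_square_extends
  (framed : is_framed_bicategory C)
  (equalizers : has_equalizers (C1 C))
  (source_preserves : preserves_equalizers (d0 C))
  (target_preserves : preserves_equalizers (d1 C))
  (ind : forall (E : homcat X Y) (x : hom (Q ⊙ E) E) (e : hom E (T ⊙ F))
    (f : hom F E), e ∘ f = act_eta nT F ->
    e ∘ x = act_mu mT F ∘ (j ▷ (T ⊙ F)) ∘ (Q ◁ e) ->
    exists r : hom (T ⊙ F) E, e ∘ r = idm (T ⊙ F)) e1 e2 :
  hsq al us e1 ∘s cell_sq c = cell_sq p' ∘s hsq vs al e2.
Proof.
transitivity lhs; [apply sqcomp_congr; [apply hsq_congr|]; reflexivity|].
transitivity rhs;
  [|apply sqcomp_congr; [|apply hsq_congr]; reflexivity].
assert (B0 : bd0 lhs = u) by (unfold lhs; bd).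
assert (B1 : bd1 lhs = v) by (unfold lhs; bd).
assert (B2 : bd0 rhs = u) by (unfold rhs; bd).
assert (B3 : bd1 rhs = v) by (unfold rhs; bd).
destruct (globular_weak_equalizer framed equalizers source_preserves
  target_preserves (a := lhs) (b := rhs)) as [E [e [Ee U]]]; [congruence..|].
destruct (U F (act_eta nT F) lhs_rhs_unit) as [f Ef].
destruct (U (Q ⊙ E) (act ∘ (Q ◁ e))) as [x Ex].
{ assert (I1 : bd1 lhs = bd0 (vs ∘s cell_sq j)) by (rewrite B1; bd).
  assert (I2 : bd1 rhs = bd0 (vs ∘s cell_sq j)) by (rewrite B3; bd).
  pose proof (lhs_action I1) as A1. pose proof (rhs_action I2) as A2.
  assert (M : forall (a : sq (T ⊙ F) (F' ⊙ P')) h h',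
    hsq (vs ∘s cell_sq j) a h ∘s cell_sq (Q ◁ e)
    = hsq (vs ∘s cell_sq j) (a ∘s cell_sq e) h').
  { intros a h h'. unfold cell_sq. cbn.
    apply hsq_merge; [apply sqcomp_idr | reflexivity]. }
  change (cell_sq (act ∘ (Q ◁ e))) with (cell_sq act ∘s cell_sq (Q ◁ e)).
  rewrite !sqcomp_assoc. etransitivity.
  { exact (f_equal (fun z => z ∘s cell_sq (Q ◁ e)) A1). }
  symmetry. etransitivity.
  { exact (f_equal (fun z => z ∘s cell_sq (Q ◁ e)) A2). }
  assert (H1 : bd1 (lhs ∘s cell_sq e) = bd0 (vs ∘s cell_sq j))
    by (rewrite bd1_comp, B1; bd).
  assert (H2 : bd1 (rhs ∘s cell_sq e) = bd0 (vs ∘s cell_sq j))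
    by (rewrite bd1_comp, B3; bd).
  rewrite <- !sqcomp_assoc. apply sqcomp_congr; [reflexivity|].
  etransitivity; [exact (M rhs _ H2)|]. symmetry.
  etransitivity; [exact (M lhs _ H1)|].
  apply hsq_congr; [reflexivity | exact Ee]. }
destruct (ind E x e f Ef Ex) as [r Er].
apply (f_equal (fun z => cell_sq z)) in Er.
change (cell_sq e ∘s cell_sq r = sqid _) in Er.
rewrite <- (sqcomp_idr lhs), <- (sqcomp_idr rhs).
transitivity (lhs ∘s (cell_sq e ∘s cell_sq r)); [f_equal; symmetry; exact Er|].
transitivity (rhs ∘s (cell_sq e ∘s cell_sq r)); [|f_equal; exact Er].
rewrite !sqcomp_assoc. f_equal. exact Ee.
Qed.
End FreeSquare.

(** * The vertical universal property *)

Section Vertical.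
Variable C : DoubleCat.
Local Notation HC := (horizontal_bicat C).
Hypothesis framed : is_framed_bicategory C.

(** The structure of [R] is induced from that of [P] along the cartesian square
    [r], and each law may be checked after composition with [r]. *)
Lemma restriction_monad (X X' : HC) (P : homcat X' X')
  (m : MonadStr (MkEndo P)) (u : @hom C X X') :
  exists (R : homcat X X) (r : sq R P) (mR : MonadStr (MkEndo R)),
    bd0 r = u /\ bd1 r = u /\
    (forall (G : homcat X X) (h : sq G P), bd0 h = u -> bd1 h = u ->
      exists l : hom G R, r ∘s cell_sq l = h) /\
    (forall (G : homcat X X) (a b : hom G R),
      r ∘s cell_sq a = r ∘s cell_sq b -> a = b) /\
    (forall e, r ∘s cell_sq (mu mR) = cell_sq (mu m) ∘s hsq r r e) /\
    r ∘s cell_sq (eta mR) = cell_sq (eta m) ∘s hidsq u.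
Proof.
destruct (restriction_globular framed P u u) as [R [r [R0 [R1 [lift ext]]]]].
destruct (lift (R ⊙ R) (cell_sq (mu m) ∘s (r ** r))) as [mR EmR]; [bd..|].
destruct (lift (id1 X) (cell_sq (eta m) ∘s hidsq u)) as [nR EnR]; [bd..|].
assert (Em : forall e, r ∘s cell_sq mR = cell_sq (mu m) ∘s hsq r r e).
{ intros e. rewrite EmR. scong. }
pose proof (f_equal (fun z => cell_sq z) (mu_assoc m)) as A.
pose proof (f_equal (fun z => cell_sq z) (mu_unitl m)) as U.
pose proof (f_equal (fun z => cell_sq z) (mu_unitr m)) as V.
unfold cell_sq in A, U, V. cbn in A, U, V.
assert (L1 : mR ∘ (mR ▷ R) ∘ asc R R R = mR ∘ (R ◁ mR)).
{ apply ext. unfold cell_sq. cbn.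
  assert (E1 : forall e1 e2, hsq r r e1 ∘s hsq (cell_sq mR) (sqid R) e2
    = (cell_sq (mu m) ** sqid P) ∘s ((r ** r) ** r)).
  { intros. apply hsq_sq_eq; [apply Em|].
    rewrite sqcomp_idl, sqcomp_idr. reflexivity. }
  assert (E2 : forall e1 e2, hsq r r e1 ∘s hsq (sqid R) (cell_sq mR) e2
    = (sqid P ** cell_sq (mu m)) ∘s (r ** (r ** r))).
  { intros. apply hsq_sq_eq; [|apply Em].
    rewrite sqcomp_idl, sqcomp_idr. reflexivity. }
  unfold cell_sq in *. cbn in *. sassoc.
  assert (e : bd1 r = bd0 r) by bd.
  srw (Em e). srw (Em e). srw E1. srw hasc_nat_from. srw E2.
  rewrite !sqcomp_assoc. apply sqcomp_congr; [|scong].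
  etransitivity; [|etransitivity; [exact A|]]; scong. }
assert (L2 : mR ∘ (nR ▷ R) = lun R).
{ apply ext. unfold cell_sq. cbn.
  assert (E1 : forall e1 e2, hsq r r e1 ∘s hsq (cell_sq nR) (sqid R) e2
    = (cell_sq (eta m) ** sqid P) ∘s (hidsq u ** r)).
  { intros. apply hsq_sq_eq; [exact EnR|].
    rewrite sqcomp_idl, sqcomp_idr. reflexivity. }
  unfold cell_sq in *. cbn in *. assert (e : bd1 r = bd0 r) by bd.
  srw (Em e). rewrite E1, sqcomp_assoc.
  assert (e' : bd1 r = bd0 (hidsq (bd1 r))) by bd.
  transitivity (hlun P ∘s hsq (hidsq (bd1 r)) r e'); [|apply hlun_nat].
  apply sqcomp_congr; [etransitivity; [|exact U]; scong|].
  apply hsq_congr; [congruence | reflexivity]. }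
assert (L3 : mR ∘ (R ◁ nR) = run R).
{ apply ext. unfold cell_sq. cbn.
  assert (E1 : forall e1 e2, hsq r r e1 ∘s hsq (sqid R) (cell_sq nR) e2
    = (sqid P ** cell_sq (eta m)) ∘s (r ** hidsq u)).
  { intros. apply hsq_sq_eq; [|exact EnR].
    rewrite sqcomp_idl, sqcomp_idr. reflexivity. }
  unfold cell_sq in *. cbn in *. assert (e : bd1 r = bd0 r) by bd.
  srw (Em e). rewrite E1, sqcomp_assoc.
  assert (e' : bd1 (hidsq (bd0 r)) = bd0 r) by bd.
  transitivity (hrun P ∘s hsq r (hidsq (bd0 r)) e'); [|apply hrun_nat].
  apply sqcomp_congr; [etransitivity; [|exact V]; scong|].
  apply hsq_congr; [reflexivity | congruence]. }
exists R, r, (@Build_MonadStr HC (MkEndo R) mR nR L1 L2 L3).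
repeat split; assumption.
Qed.

(** Squares over [(u,u)] into [P] correspond to globular cells into the
    restriction [R] of [P], and those compatible with the monad structures
    correspond to morphisms of monoids. *)
Lemma vertical_extension (X X' : HC) (Q S : homcat X X)
  (m : MonadStr (MkEndo S)) (i : hom Q S) (free : is_free_monad m i)
  (P : homcat X' X') (n : MonadStr (MkEndo P)) (u : @hom C X X') (q : sq Q P) :
  bd0 q = u -> bd1 q = u ->
  exists! w : sq S P, bd0 w = u /\ bd1 w = u /\
    (forall e, w ∘s cell_sq (mu m) = cell_sq (mu n) ∘s hsq w w e) /\
    w ∘s cell_sq (eta m) = cell_sq (eta n) ∘s hidsq u /\
    w ∘s cell_sq i = q.
Proof.
intros Q0 Q1.
destruct (restriction_monad n u) as
  [R [r [mR [R0 [R1 [lift [ext [Em En]]]]]]]].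
assert (mon : forall b : hom S R,
  (b ∘ mu m = mu mR ∘ (b ⋆ b) /\ b ∘ eta m = eta mR) <->
  (forall e, (r ∘s cell_sq b) ∘s cell_sq (mu m)
     = cell_sq (mu n) ∘s hsq (r ∘s cell_sq b) (r ∘s cell_sq b) e) /\
  (r ∘s cell_sq b) ∘s cell_sq (eta m) = cell_sq (eta n) ∘s hidsq u).
{ intros b.
  assert (E : bd1 r = bd0 r) by bd.
  assert (E1 : forall e, r ∘s cell_sq (mu mR ∘ (b ⋆ b))
    = cell_sq (mu n) ∘s hsq (r ∘s cell_sq b) (r ∘s cell_sq b) e).
  { intros e. transitivity (cell_sq (mu n) ∘s hsq r r E ∘s cell_sq (b ⋆ b)).
    - rewrite <- Em. unfold cell_sq. cbn. apply sqcomp_assoc.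
    - rewrite <- sqcomp_assoc. apply sqcomp_congr; [reflexivity|].
      unfold cell_sq. cbn. apply hsq_merge; reflexivity. }
  split; intros [H1 H2]; split.
  - intros e. rewrite <- E1, <- H1. unfold cell_sq. cbn.
    symmetry; apply sqcomp_assoc.
  - rewrite <- En, <- H2. unfold cell_sq. cbn. symmetry; apply sqcomp_assoc.
  - apply ext. assert (e : bd1 (r ∘s cell_sq b) = bd0 (r ∘s cell_sq b)) by bd.
    etransitivity; [|symmetry; exact (E1 e)]. rewrite <- (H1 e).
    unfold cell_sq. cbn. apply sqcomp_assoc.
  - apply ext. etransitivity; [|symmetry; exact En]. rewrite <- H2.
    unfold cell_sq. cbn. apply sqcomp_assoc. }
destruct (lift Q q Q0 Q1) as [a Ea].
destruct (free_monad_monoid free mR a) as [b [[L1 [L2 L3]] U]].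
exists (r ∘s cell_sq b). split.
- split; [bd|]. split; [bd|]. destruct (proj1 (mon b) (conj L1 L2)) as [H1 H2].
  split; [exact H1|]. split; [exact H2|]. rewrite <- Ea, <- L3.
  unfold cell_sq. cbn. symmetry; apply sqcomp_assoc.
- intros w [W0 [W1 [W2 [W3 W4]]]].
  destruct (lift S w W0 W1) as [b' Eb']. rewrite <- Eb' in W2, W3, W4 |- *.
  destruct (proj2 (mon b') (conj W2 W3)) as [H1 H2].
  f_equal. f_equal. apply U. split; [exact H1|]. split; [exact H2|].
  apply ext. rewrite Ea, <- W4. unfold cell_sq. cbn. apply sqcomp_assoc.
Qed.
End Vertical.

(** * Construction of the left adjoint *)

Section Construction.
Variable C : DoubleCat.
Local Notation HC := (horizontal_bicat C).
Hypothesis framed : is_framed_bicategory C.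
Hypothesis equalizers : has_equalizers (C1 C).
Hypothesis source_preserves : preserves_equalizers (d0 C).
Hypothesis target_preserves : preserves_equalizers (d1 C).

Lemma VEndMap_eq (A B : Endo HC) (w w' : VEndMap A B) :
  vsq w = vsq w' -> w = w'.
Proof.
destruct w as [v s e0 e1], w' as [v' s' e0' e1']. simpl. intros <-.
assert (E : v = v') by congruence. destruct E.
f_equal; apply proof_irrelevance.
Qed.

Lemma VMonadMap_eq (M N : Monad HC) (w w' : VMonadMap M N) :
  vsq w = vsq w' -> w = w'.
Proof.
destruct w as [w h1 h2], w' as [w' h1' h2']. simpl. intros E.
apply VEndMap_eq in E. subst w'. f_equal; apply proof_irrelevance.
Qed.

Lemma EndSquare_eq (A B A' B' : Endo HC) (f : EndMap A B) (f' : EndMap A' B')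
  (u : VEndMap A A') (v : VEndMap B B') (a b : EndSquare f f' u v) :
  esq a = esq b -> a = b.
Proof.
destruct a as [a p0 p1 p2], b as [b q0 q1 q2]. simpl. intros <-.
assert (p0 = q0) by apply proof_irrelevance.
assert (p1 = q1) by apply proof_irrelevance. subst.
f_equal. apply proof_irrelevance.
Qed.

Lemma cast_bottom_refl (X Y X' Y' : C) (F : hor X Y) (F' : hor X' Y')
  (e : F' = F') (a : sq F F') : cast_bottom e a = a.
Proof. rewrite (proof_irrelevance _ e eq_refl). reflexivity. Qed.

Lemma MonadMap_eq_cell (M N : Monad HC) (F : homcat (carrier M) (carrier N))
  (c c' : hom (endo N ⊙ F) (F ⊙ endo M)) :
  c = c' -> @MkEndMap HC M N F c = @MkEndMap HC M N F c'.
Proof. intros <-. reflexivity. Qed.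

Variable S : forall A : Endo HC, homcat (carrier A) (carrier A).
Variable m : forall A : Endo HC, MonadStr (MkEndo (S A)).
Variable i : forall A : Endo HC, hom (endo A) (S A).
Hypothesis free : forall A : Endo HC, is_free_monad (m A) (i A).

Definition free_monad (A : Endo HC) : Monad HC := MkMonad (m A).

Definition unit_vmap (A : Endo HC) : VEndMap A (free_monad A) :=
  @MkVEndMap C A (free_monad A) (idm (carrier A)) (cell_sq (i A))
    (gsq0 (i A)) (gsq1 (i A)).

Lemma vertical_transpose (A : Endo HC) (M : Monad HC) (u : VEndMap A M) :
  exists w : VMonadMap (free_monad A) M,
    VEndMap_comp w (unit_vmap A) = u /\
    forall w' : VMonadMap (free_monad A) M,
      VEndMap_comp w' (unit_vmap A) = u -> w' = w.
Proof.
destruct M as [[X' P] n]. simpl in n.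
destruct (vertical_extension framed (free A) n (vsq0 u) (vsq1 u))
  as [w [[W0 [W1 [W2 [W3 W4]]]] U]].
pose (w1 := @MkVEndMap C (free_monad A) (MkEndo P) (vmap u) w W0 W1).
exists (@MkVMonadMap C (free_monad A) (MkMonad n) w1 (W2 _) W3). split.
- apply VEndMap_eq. exact W4.
- intros [w' H1 H2] <-. apply VMonadMap_eq. simpl. symmetry. apply U. simpl.
  split; [rewrite comp_idr; exact (@vsq0 C _ _ w')|].
  split; [rewrite comp_idr; exact (@vsq1 C _ _ w')|].
  split; [|split; [|reflexivity]].
  + intros e. etransitivity; [exact H1|]. scong.
  + rewrite comp_idr. exact H2.
Qed.

Lemma horizontal_transpose (A B : Endo HC) (f : EndMap A B) :
  exists c : hom (S B ⊙ emap f) (emap f ⊙ S A),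
    @monad_map_laws HC (free_monad A) (free_monad B) (emap f) c /\
    c ∘ (i B ▷ emap f) = (emap f ◁ i A) ∘ ecell f.
Proof. exact (free_monad_lift (free B) (M := free_monad A) _). Qed.

Definition free_cell (A B : Endo HC) (f : EndMap A B) :=
  constructive_indefinite_description _ (horizontal_transpose f).

(** The underlying horizontal arrow is [emap f] by definition, so the casts in the
    functoriality conditions are along reflexivity. *)
Definition free_map (A B : Endo HC) (f : EndMap A B) :
  MonadMap (free_monad A) (free_monad B) :=
  mk_monad_map (proj1 (proj2_sig (free_cell f))).

Lemma free_map_eq (A B : Endo HC) (f : EndMap A B)
  (c : hom (S B ⊙ emap f) (emap f ⊙ S A)) :
  @monad_map_laws HC (free_monad A) (free_monad B) (emap f) c ->
  c ∘ (i B ▷ emap f) = (emap f ◁ i A) ∘ ecell f ->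
  mmap (free_map f) = @MkEndMap HC (free_monad A) (free_monad B) (emap f) c.
Proof.
intros L E. apply MonadMap_eq_cell.
apply (free_monad_unique (free B) (M := free_monad A)); [| exact L |].
- exact (proj1 (proj2_sig (free_cell f))).
- etransitivity; [exact (proj2 (proj2_sig (free_cell f)))|]. symmetry. exact E.
Qed.

Definition unit_square (A B : Endo HC) (f : EndMap A B) :
  EndSquare f (free_map f) (unit_vmap A) (unit_vmap B).
Proof.
refine (@MkEndSquare C A B (free_monad A) (free_monad B) f (free_map f)
  (unit_vmap A) (unit_vmap B) (sqid (emap f)) (bd0_id _) (bd1_id _) _).
etransitivity; [|etransitivity;
  [exact (f_equal (fun z => cell_sq z)
     (eq_sym (proj2 (proj2_sig (free_cell f)))))|]];
unfold cell_sq; cbn; scong.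
Defined.

Lemma unit_square_universal (A B : Endo HC) (f : EndMap A B) (M N : Monad HC)
  (f' : MonadMap M N) (us : VMonadMap (free_monad A) M)
  (vs : VMonadMap (free_monad B) N) (u : VEndMap A M) (v : VEndMap B N)
  (a : EndSquare f f' u v) :
  VEndMap_comp us (unit_vmap A) = u -> VEndMap_comp vs (unit_vmap B) = v ->
  exists! b : EndSquare (free_map f) f' us vs,
    esq b ∘s esq (unit_square f) = esq a.
Proof.
intros Eu Ev. subst u v. destruct a as [a a0 a1 aeq].
assert (b0 : bd0 a = vmap us) by (rewrite a0; apply comp_idr).
assert (b1 : bd1 a = vmap vs) by (rewrite a1; apply comp_idr).
simpl in aeq.
assert (eq : hsq a (vsq us) (eq_trans (vsq1 us) (eq_sym b0))
    ∘s cell_sq (ecell (free_map f))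
  = cell_sq (ecell f') ∘s hsq (vsq vs) a (eq_trans b1 (eq_sym (vsq0 vs)))).
{ destruct (proj2_sig (free_cell f)) as [[L1 L2] L3].
  eapply (endomorphism_square_extends (c := proj1_sig (free_cell f))
    (p' := ecell f') L1 L2 (mmap_mu f') (mmap_eta f') L3 (vsq0 us) (vsq1 us)
    (vsq0 vs) (vsq1 vs) b0 b1).
  - intros e. etransitivity; [exact (vmnd_mu us)|]. scong.
  - exact (vmnd_eta us).
  - intros e. etransitivity; [exact (vmnd_mu vs)|]. scong.
  - exact (vmnd_eta vs).
  - intros e e'. etransitivity; [|etransitivity; [exact aeq|]]; scong.
  - exact framed.
  - exact equalizers.
  - exact source_preserves.
  - exact target_preserves.
  - intros E x e g. apply (free_algebra_induction (free B)). }
exists (@MkEndSquare C (free_monad A) (free_monad B) M N (free_map f) f' us vs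
  a b0 b1 eq). split.
- apply sqcomp_idr.
- intros b Eb. apply EndSquare_eq. simpl in *. rewrite <- Eb. apply sqcomp_idr.
Qed.

Lemma free_map_id (A : Endo HC) :
  mmap (free_map (EndMap_id A)) = EndMap_id (free_monad A).
Proof.
apply (free_map_eq (f := EndMap_id A)
  (c := lun_inv (S A) ∘ run (S A))).
- exact (identity_laws (m A)).
- exact (identity_cell_nat (i A)).
Qed.

Lemma free_map_comp (A B D : Endo HC) (g : EndMap B D) (f : EndMap A B) :
  mmap (free_map (EndMap_comp g f)) = EndMap_comp (free_map g) (free_map f).
Proof.
destruct (proj2_sig (free_cell g)) as [[Lg1 Lg2] Eg].
destruct (proj2_sig (free_cell f)) as [[Lf1 Lf2] Ef].
apply (free_map_eq (f := EndMap_comp g f)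
  (c := comp_cell (proj1_sig (free_cell g)) (proj1_sig (free_cell f)))).
- split; [exact (mu_law_comp Lg1 Lf1) | exact (eta_law_comp Lg2 Lf2)].
- exact (comp_cell_extend Eg Ef).
Qed.

Theorem free_monads_exist : double_admits_free_monads C.
Proof.
constructor.
pose (sh := fun A M (u : VEndMap A (mendo M)) =>
  constructive_indefinite_description _ (vertical_transpose u)).
refine (@Build_FreeMonads C free_monad unit_vmap
  (fun A M u => proj1_sig (sh A M u))
  (fun A M u => proj1 (proj2_sig (sh A M u)))
  (fun A M u => proj2 (proj2_sig (sh A M u)))
  free_map unit_square _ free_map_id free_map_comp _ _).
- intros A B f M N f' u v a.
  apply (unit_square_universal a); apply (proj2_sig (sh _ _ _)).
- intros A. transitivity (sqid (hid (carrier A))); [|symmetry; apply hidsq_id].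
  exact (@cast_bottom_refl _ _ _ _ _ (hid (carrier A)) _
    (sqid (hid (carrier A)))).
- intros A B D g f.
  transitivity (sqid (hcomp (emap g) (emap f))); [|symmetry; apply hsq_id].
  exact (@cast_bottom_refl _ _ _ _ _ (hcomp (emap g) (emap f)) _ (sqid _)).
Qed.
End Construction.

Unset Implicit Arguments.

Theorem theorem3p7 (C : DoubleCat)
  (framed : is_framed_bicategory C)
  (equalizers : has_equalizers (C1 C))
  (source_preserves : preserves_equalizers (d0 C))
  (target_preserves : preserves_equalizers (d1 C))
  (local_coproducts : has_local_coproducts (horizontal_bicat C))
  (free_monads : admits_free_monads (horizontal_bicat C)) :
  double_admits_free_monads C.
Proof.
pose (pick := fun A : Endo (horizontal_bicat C) => free_monads _ (endo A)).
pose (S := fun A => constructive_indefinite_description _ (pick A)).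
pose (m := fun A => constructive_indefinite_description _ (proj2_sig (S A))).
pose (i := fun A => constructive_indefinite_description _ (proj2_sig (m A))).
exact (free_monads_exist framed equalizers source_preserves target_preserves
  (fun A => proj2_sig (i A))).
Qed.
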